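(* Let $c_1,c_2,c_3\in\mathbb{C}$ with $c_1\neq0$ or $c_2\neq0$, and let $L=c_1\partial_t+c_2\partial_x+c_3$ on $\mathbb{T}^1\times\mathbb{R}$. Then for every $f\in\mathcal{S}(\mathbb{T}^1\times\mathbb{R})$ such that $\widetilde{f}(k,\xi)=0$ for all $(k,\xi)\in\mathbb{Z}\times\mathbb{R}$ with $p(k,\xi)=0$, where $p(k,\xi)=ic_1k+ic_2\xi+c_3$, there exists $u\in\mathcal{S}(\mathbb{T}^1\times\mathbb{R})$ with $Lu=f$; that is, $L$ is globally solvable.
   Context: $\mathbb{T}^1=\mathbb{R}/2\pi\mathbb{Z}$. $\mathcal{S}(\mathbb{T}^1\times\mathbb{R})$ is the space of $f\in C^\infty(\mathbb{T}^1\times\mathbb{R})$ with $\sup_{t,x}|x^\gamma\partial_t^\alpha\partial_x^\beta f(t,x)|<\infty$ for all $\alpha,\beta,\gamma\in\mathbb{N}_0$. The mixed partial Fourier transform of $f$ is $\widetilde{f}(k,\xi)=\frac{1}{2\pi}\int_0^{2\pi}\int_{\mathbb{R}}f(t,x)e^{-i(kt+x\xi)}\,dx\,dt$ for $k\in\mathbb{Z}$, $\xi\in\mathbb{R}$; with this transform $\widetilde{Lv}(k,\xi)=p(k,\xi)\widetilde{v}(k,\xi)$. For a constant coefficient operator with symbol $p$ in this sense, ''globally solvable'' means: for every $f\in\mathcal{S}(\mathbb{T}^1\times\mathbb{R})$ with $\widetilde f=0$ on the zero set of $p$ there is $u\in\mathcal{S}(\mathbb{T}^1\times\mathbb{R})$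 with $Lu=f$. *)

(* Defs.v *)
From Stdlib Require Import Reals List.
From Coquelicot Require Import Coquelicot.
Open Scope R_scope.

(* A function on T^1 x R is represented as f : R -> R -> C (f t x), 2pi-periodic in t. *)
Definition periodic_t (f : R -> R -> C) : Prop :=
  forall t x, f (t + 2 * PI) x = f t x.

Definition dt (f : R -> R -> C) : R -> R -> C :=
  fun t x => (Derive (fun s => Re (f s x)) t, Derive (fun s => Im (f s x)) t) : C.
Definition dx (f : R -> R -> C) : R -> R -> C :=
  fun t x => (Derive (fun y => Re (f t y)) x, Derive (fun y => Im (f t y)) x) : C.

Definition has_dt (f : R -> R -> C) : Prop :=
  forall t x, ex_derive (fun s => Re (f s x)) t /\ ex_derive (fun s => Im (f s x)) t.
Definition has_dx (f : R -> R -> C) : Prop :=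
  forall t x, ex_derive (fun y => Re (f t y)) x /\ ex_derive (fun y => Im (f t y)) x.

Fixpoint dword (w : list bool) (f : R -> R -> C) : R -> R -> C :=
  match w with
  | nil => f
  | b :: w' => if b then dt (dword w' f) else dx (dword w' f)
  end.

Definition cont2 (g : R -> R -> C) : Prop :=
  forall t x, continuous (fun p : R * R => g (fst p) (snd p)) (t, x).

Definition smooth2 (f : R -> R -> C) : Prop :=
  forall w : list bool,
    has_dt (dword w f) /\ has_dx (dword w f) /\ cont2 (dword w f).

Definition dtx (a b : nat) (f : R -> R -> C) : R -> R -> C :=
  Nat.iter a dt (Nat.iter b dx f).

Definition schwartz (f : R -> R -> C) : Prop :=
  periodic_t f /\ smooth2 f /\
  forall a b g : nat, exists M : R, forall t x,
    Cmod (RtoC (x ^ g) * dtx a b f t x)%C <= M.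

Definition cexpmi (theta : R) : C := (cos theta, - sin theta).

Definition fourier (f : R -> R -> C) (k : Z) (xi : R) : C :=
  scal (/ (2 * PI))
    (RInt (V := C_R_CompleteNormedModule)
       (fun t => RInt_gen (V := C_R_CompleteNormedModule)
                  (fun x => (f t x * cexpmi (IZR k * t + x * xi))%C)
                  (Rbar_locally m_infty) (Rbar_locally p_infty))
       0 (2 * PI)).

Definition Lop (c1 c2 c3 : C) (u : R -> R -> C) : R -> R -> C :=
  fun t x => (c1 * dt u t x + c2 * dx u t x + c3 * u t x)%C.

Definition symb (c1 c2 c3 : C) (k : Z) (xi : R) : C :=
  (Ci * c1 * RtoC (IZR k) + Ci * c2 * RtoC xi + c3)%C.

(* Main.v *)
Require Import Defs.
From Stdlib Require Import Reals Lra Lia ZArith List FunctionalExtensionality ClassicalEpsilon.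
From Coquelicot Require Import Coquelicot.
Open Scope R_scope.

(** Expand [f] in a Fourier series in [t]: [f(t,x) = sum_k f_k(x) exp(ikt)], where the [f_k] together
    with their derivatives decay faster than any power of [|k|] and [|x|].  On the [k]-th mode [L] acts
    as [c2 d/dx + (i c1 k + c3)].

    If [c2 <> 0], put [lam_k = (i c1 k + c3) / c2] and solve [u' + lam_k u = f_k / c2] by integrating
    [exp(lam_k y) f_k(y) / c2] from [-oo] when [Re lam_k >= 0] and from [+oo] when [Re lam_k < 0].  As
    [Re lam_k] runs through an arithmetic progression, it is either 0 or bounded away from 0.  In the
    latter case the weighted sup norms of [u_k] are bounded by those of [f_k] uniformly in [k].  If
    [Re lam_k = 0], the symbol vanishes at [xi = - Im lam_k] and the hypothesis says that the total
    integral is 0, so that the primitive decays at both ends.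

    If [c2 = 0], divide by [i c1 k + c3], which is again 0 or bounded away from 0.  Where it is 0 the
    whole Fourier transform of [f_k] vanishes, so [f_k = 0]; this injectivity is obtained by periodizing
    [f_k] with a large period and using the uniqueness theorem for Fourier series. *)

(** * Complex-valued functions of a real variable *)

(** Every estimate has to hold uniformly in [k], and this dictates the form of the intermediate
    statements. Improper integrals are handled through truncations to [[-X, Y]] with the explicit
    error [B * (atail X + atail Y)], where [atail] is the tail of the integral of [1 / (1 + x^2)];
    even the vanishing of a Fourier transform is expressed in this way. Series are likewise compared
    with [B / (1 + k^2)], so that [B] alone fixes the rate of convergence. For [c2 <> 0] the side of
    integration is the one on which the kernel [exp(-lam_k (x - y))] is bounded. If [Re lam_k] is
    bounded away from 0, exponential decay pays for moving a polynomial weight from [y] to [x]. If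
    [Re lam_k = 0], a weight can only be moved to an [x] of smaller modulus: the solution must then
    be an integral from [-oo] for [x <= 0] and from [+oo] for [x > 0], and the two have to agree.
    One factor [1 + y^2] is spent on integrability. The derivatives of [u_k] are read off the
    equation, at the cost of factors [lam_k] of linear growth in [k]. *)

Lemma C_ext (z w : C) : Re z = Re w -> Im z = Im w -> z = w.
Proof. destruct z, w; simpl; intros -> ->; reflexivity. Qed.

Lemma Cmod_le_sum (z : C) : Cmod z <= Rabs (Re z) + Rabs (Im z).
Proof.
  replace z with (RtoC (Re z) + Ci * RtoC (Im z))%C
    by (apply C_ext; simpl; ring).
  eapply Rle_trans; [apply Cmod_triangle|].
  rewrite Cmod_mult, Cmod_Ci, !Cmod_R; simpl.
  replace (Re z + (0 * Im z - 1 * 0)) with (Re z) by ring.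
  replace (0 + (0 * 0 + 1 * Im z)) with (Im z) by ring. lra.
Qed.

Lemma Im_le_Cmod (z : C) : Rabs (Im z) <= Cmod z.
Proof. eapply Rle_trans; [apply Rmax_r|apply Rmax_Cmod]. Qed.

Lemma Cmod_small_eq (z w : C) :
  (forall eps, 0 < eps -> Cmod (z - w)%C <= eps) -> z = w.
Proof.
  intros H.
  assert (E : Cmod (z - w)%C = 0).
  { destruct (Rle_lt_dec (Cmod (z - w)%C) 0) as [h|h].
    - apply Rle_antisym; [exact h|apply Cmod_ge_0].
    - specialize (H (Cmod (z - w)%C / 2)). lra. }
  apply Cmod_eq_0 in E.
  replace z with ((z - w) + w)%C by ring. rewrite E. ring.
Qed.

(** Lets a bound pass from approximants to a limit without naming the limit process; the solution of
    a mode is bounded through its truncated integrals in this way. *)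
Lemma Cmod_le_eps (z : C) (B : R) :
  (forall eps, 0 < eps -> exists w, Cmod (z - w)%C <= eps /\ Cmod w <= B) ->
  Cmod z <= B.
Proof.
  intros H. apply le_epsilon. intros eps he.
  destruct (H eps he) as [w [h1 h2]].
  replace z with ((z - w) + w)%C by ring.
  eapply Rle_trans; [apply Cmod_triangle|]. lra.
Qed.

Lemma Cmod_minus_sym (z w : C) : Cmod (z - w)%C = Cmod (w - z)%C.
Proof. rewrite <- Cmod_opp. f_equal. ring. Qed.

(** Continuity, derivative and integral are taken componentwise to match [dt] and [dx], which
    differentiate [Re] and [Im] separately; real calculus then applies to each part. *)
Definition ccont (h : R -> C) : Prop :=
  forall x : R, continuous (fun y => Re (h y)) x /\ continuous (fun y => Im (h y)) x.
Definition cderiv (h h' : R -> C) : Prop :=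
  forall x : R, is_derive (fun y => Re (h y)) x (Re (h' x)) /\
                is_derive (fun y => Im (h y)) x (Im (h' x)).
Definition CRInt (h : R -> C) (a b : R) : C :=
  (RInt (fun x => Re (h x)) a b, RInt (fun x => Im (h x)) a b).

Lemma cderiv_ccont h h' : cderiv h h' -> ccont h.
Proof.
  intros H x; destruct (H x) as [h1 h2]; split;
  apply (ex_derive_continuous (K := R_AbsRing) (V := R_NormedModule)); eexists; eassumption.
Qed.

Lemma ccont_const c : ccont (fun _ => c).
Proof. intros x; split; apply continuous_const. Qed.

Lemma ccont_plus h k : ccont h -> ccont k -> ccont (fun x => (h x + k x)%C).
Proof.
  intros H K x; destruct (H x), (K x); split; simpl;
  apply (continuous_plus (V := R_NormedModule)); assumption.
Qed.

Lemma ccont_opp h : ccont h -> ccont (fun x => (- h x)%C).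
Proof.
  intros H x; destruct (H x); split; simpl;
  apply (continuous_opp (V := R_NormedModule)); assumption.
Qed.

Lemma ccont_minus h k : ccont h -> ccont k -> ccont (fun x => (h x - k x)%C).
Proof. intros; apply ccont_plus; [|apply ccont_opp]; assumption. Qed.

Lemma ccont_mult h k : ccont h -> ccont k -> ccont (fun x => (h x * k x)%C).
Proof.
  intros H K x; destruct (H x), (K x); split; simpl.
  - apply (continuous_minus (V := R_NormedModule)); apply (continuous_mult (K := R_AbsRing)); assumption.
  - apply (continuous_plus (V := R_NormedModule)); apply (continuous_mult (K := R_AbsRing)); assumption.
Qed.

Lemma ccont_comp h (g : R -> R) : ccont h -> (forall x, continuous g x) -> ccont (fun x => h (g x)).
Proof.
  intros H K x; split.
  - exact (continuous_comp g (fun y => Re (h y)) x (K x) (proj1 (H (g x)))).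
  - exact (continuous_comp g (fun y => Im (h y)) x (K x) (proj2 (H (g x)))).
Qed.

Lemma ccont_RtoC (g : R -> R) : (forall x, continuous g x) -> ccont (fun x => RtoC (g x)).
Proof. intros K x; split; [apply K|apply continuous_const]. Qed.

Lemma cderiv_const c : cderiv (fun _ => c) (fun _ => RtoC 0).
Proof. intros x; split; apply (is_derive_const (K := R_AbsRing) (V := R_NormedModule)). Qed.

Lemma cderiv_plus h k h' k' : cderiv h h' -> cderiv k k' -> cderiv (fun x => (h x + k x)%C) (fun x => (h' x + k' x)%C).
Proof.
  intros H K x; destruct (H x), (K x); split; simpl;
  apply (is_derive_plus (K := R_AbsRing) (V := R_NormedModule)); assumption.
Qed.

Lemma cderiv_mult h k h' k' : cderiv h h' -> cderiv k k' ->
  cderiv (fun x => (h x * k x)%C) (fun x => (h' x * k x + h x * k' x)%C).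
Proof.
  intros H K x; destruct (H x) as [a b], (K x) as [c d].
  assert (M : forall (f g : R -> R) df dg, is_derive f x df -> is_derive g x dg ->
     is_derive (fun y => f y * g y) x (df * g x + f x * dg)).
  { intros f g df dg D1 D2. apply (is_derive_mult (K := R_AbsRing) f g); auto. exact Rmult_comm. }
  split.
  - replace (Re (h' x * k x + h x * k' x)%C) with
      ((Re (h' x) * Re (k x) + Re (h x) * Re (k' x)) - (Im (h' x) * Im (k x) + Im (h x) * Im (k' x)))
      by (simpl; unfold Re, Im; ring).
    apply (is_derive_minus (K := R_AbsRing) (V := R_NormedModule)
      (fun y => Re (h y) * Re (k y)) (fun y => Im (h y) * Im (k y))); apply M; auto.
  - replace (Im (h' x * k x + h x * k' x)%C) with
      ((Re (h' x) * Im (k x) + Re (h x) * Im (k' x)) + (Im (h' x) * Re (k x) + Im (h x) * Re (k' x)))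
      by (simpl; unfold Re, Im; ring).
    apply (is_derive_plus (K := R_AbsRing) (V := R_NormedModule)
      (fun y => Re (h y) * Im (k y)) (fun y => Im (h y) * Re (k y))); apply M; auto.
Qed.

Lemma cderiv_ext h h' k k' : (forall x, h x = k x) -> (forall x, h' x = k' x) -> cderiv h h' -> cderiv k k'.
Proof.
  intros E1 E2 H x. rewrite <- E2. destruct (H x) as [a b]; split.
  - eapply (is_derive_ext (K := R_AbsRing) (V := R_NormedModule)); [|exact a]; simpl; intros; rewrite E1; reflexivity.
  - eapply (is_derive_ext (K := R_AbsRing) (V := R_NormedModule)); [|exact b]; simpl; intros; rewrite E1; reflexivity.
Qed.

Lemma cderiv_scal c h h' : cderiv h h' -> cderiv (fun x => (c * h x)%C) (fun x => (c * h' x)%C).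
Proof.
  intros H. eapply cderiv_ext; [reflexivity| |apply cderiv_mult; [apply (cderiv_const c)|exact H]].
  intros; simpl; ring.
Qed.

Lemma cderiv_comp_lin h h' (u v : R) : cderiv h h' ->
  cderiv (fun x => h (u * x + v)) (fun x => (RtoC u * h' (u * x + v)%R)%C).
Proof.
  intros H x. destruct (H (u * x + v)) as [a b].
  assert (D : is_derive (fun x : R => u * x + v) x u) by (auto_derive; trivial; ring).
  split.
  - replace (Re (RtoC u * h' (u * x + v)%R)%C) with (scal u (Re (h' (u * x + v))))
      by (unfold scal, Re, Im; simpl; unfold mult; simpl; ring).
    apply (is_derive_comp (K := R_AbsRing) (V := R_NormedModule) (fun y => Re (h y)) (fun x => u * x + v)); assumption.
  - replace (Im (RtoC u * h' (u * x + v)%R)%C) with (scal u (Im (h' (u * x + v))))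
      by (unfold scal, Re, Im; simpl; unfold mult; simpl; ring).
    apply (is_derive_comp (K := R_AbsRing) (V := R_NormedModule) (fun y => Im (h y)) (fun x => u * x + v)); assumption.
Qed.

Lemma ccont_ex_Re h a b : ccont h -> ex_RInt (fun x => Re (h x)) a b.
Proof. intros H; apply (ex_RInt_continuous (V := R_CompleteNormedModule)); intros z _; exact (proj1 (H z)). Qed.

Lemma ccont_ex_Im h a b : ccont h -> ex_RInt (fun x => Im (h x)) a b.
Proof. intros H; apply (ex_RInt_continuous (V := R_CompleteNormedModule)); intros z _; exact (proj2 (H z)). Qed.
#[local] Hint Resolve ccont_ex_Re ccont_ex_Im : core.

Lemma CRInt_ext h k a b : (forall x, h x = k x) -> CRInt h a b = CRInt k a b.
Proof. intros E. unfold CRInt. f_equal; apply RInt_ext; intros; rewrite E; reflexivity. Qed.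

Lemma CRInt_plus h k a b : ccont h -> ccont k -> CRInt (fun x => (h x + k x)%C) a b = (CRInt h a b + CRInt k a b)%C.
Proof.
  intros H K. apply C_ext; simpl; apply (RInt_plus (V := R_CompleteNormedModule)); auto.
Qed.

Lemma CRInt_zero a b : CRInt (fun _ => RtoC 0) a b = RtoC 0.
Proof.
  apply C_ext; simpl; rewrite RInt_const; unfold scal; simpl; unfold mult; simpl; ring.
Qed.

Lemma CRInt_scal c h a b : ccont h -> CRInt (fun x => (c * h x)%C) a b = (c * CRInt h a b)%C.
Proof.
  intros H. assert (R1 := ccont_ex_Re h a b H). assert (R2 := ccont_ex_Im h a b H).
  assert (S : forall (g : R -> R) (r : R), ex_RInt g a b ->
    RInt (fun x => r * g x) a b = r * RInt g a b /\ ex_RInt (fun x => r * g x) a b).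
  { intros g r E; split.
    - apply (RInt_scal (V := R_CompleteNormedModule)); exact E.
    - apply (ex_RInt_scal (V := R_CompleteNormedModule)); exact E. }
  apply C_ext; simpl.
  - destruct (S _ (fst c) R1) as [e1 x1], (S _ (snd c) R2) as [e2 x2].
    transitivity (minus (RInt (fun x => fst c * Re (h x)) a b) (RInt (fun x => snd c * Im (h x)) a b)).
    + symmetry; rewrite <- (RInt_minus (V := R_CompleteNormedModule)); auto.
    + rewrite e1, e2. reflexivity.
  - destruct (S _ (fst c) R2) as [e1 x1], (S _ (snd c) R1) as [e2 x2].
    transitivity (plus (RInt (fun x => fst c * Im (h x)) a b) (RInt (fun x => snd c * Re (h x)) a b)).
    + symmetry; rewrite <- (RInt_plus (V := R_CompleteNormedModule)); auto.
    + rewrite e1, e2. reflexivity.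
Qed.

Lemma CRInt_minus h k a b : ccont h -> ccont k -> CRInt (fun x => (h x - k x)%C) a b = (CRInt h a b - CRInt k a b)%C.
Proof.
  intros H K.
  transitivity (CRInt (fun x => (h x + (RtoC (-1)) * k x)%C) a b).
  - apply CRInt_ext; intros; apply C_ext; simpl; ring.
  - rewrite CRInt_plus, CRInt_scal; auto.
    + apply C_ext; simpl; ring.
    + apply ccont_mult; [apply ccont_const|auto].
Qed.

Lemma CRInt_Chasles h a b c : ccont h -> (CRInt h a b + CRInt h b c)%C = CRInt h a c.
Proof.
  intros H. apply C_ext; simpl; apply (RInt_Chasles (V := R_CompleteNormedModule)); auto.
Qed.

Lemma CRInt_point h a : CRInt h a a = RtoC 0.
Proof. apply C_ext; simpl; apply (RInt_point (V := R_CompleteNormedModule)). Qed.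

Lemma CRInt_swap h a b : ccont h -> CRInt h b a = (- CRInt h a b)%C.
Proof.
  intros H. assert (E := CRInt_Chasles h a b a H). rewrite CRInt_point in E.
  replace (CRInt h b a) with ((CRInt h a b + CRInt h b a) - CRInt h a b)%C by ring.
  rewrite E. ring.
Qed.

Lemma CRInt_FTC h h' a b : cderiv h h' -> ccont h' -> CRInt h' a b = (h b - h a)%C.
Proof.
  intros H K. apply C_ext; simpl.
  - apply (is_RInt_unique (V := R_CompleteNormedModule)).
    apply (is_RInt_derive (V := R_CompleteNormedModule) (fun x => Re (h x)) (fun x => Re (h' x))); intros z _; [exact (proj1 (H z))|exact (proj1 (K z))].
  - apply (is_RInt_unique (V := R_CompleteNormedModule)).
    apply (is_RInt_derive (V := R_CompleteNormedModule) (fun x => Im (h x)) (fun x => Im (h' x))); intros z _; [exact (proj2 (H z))|exact (proj2 (K z))].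
Qed.

Lemma cderiv_CRInt h a : ccont h -> cderiv (fun x => CRInt h a x) h.
Proof.
  intros H x; split; simpl.
  - apply (is_derive_RInt (V := R_NormedModule) (fun y => Re (h y)) (fun y => RInt (fun t => Re (h t)) a y) a x).
    + apply filter_forall. intros; apply (RInt_correct (V := R_CompleteNormedModule)); auto.
    + exact (proj1 (H x)).
  - apply (is_derive_RInt (V := R_NormedModule) (fun y => Im (h y)) (fun y => RInt (fun t => Im (h t)) a y) a x).
    + apply filter_forall. intros; apply (RInt_correct (V := R_CompleteNormedModule)); auto.
    + exact (proj2 (H x)).
Qed.

Lemma CRInt_comp_lin h (u v a b : R) : ccont h ->
  (RtoC u * CRInt (fun y => h (u * y + v)%R) a b)%C = CRInt h (u * a + v) (u * b + v).
Proof.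
  intros H.
  assert (Hc : ccont (fun y => h (u * y + v))).
  { apply (ccont_comp h (fun y => u * y + v) H). intros x.
    apply (continuous_plus (V := R_NormedModule)); [|apply continuous_const].
    apply (continuous_mult (K := R_AbsRing)); [apply continuous_const|apply continuous_id]. }
  rewrite <- CRInt_scal by auto.
  apply C_ext; simpl.
  - rewrite <- (RInt_comp_lin (V := R_CompleteNormedModule)) by (apply (ccont_ex_Re h); auto).
    apply RInt_ext; intros. unfold scal, Re; simpl; unfold mult; simpl. ring.
  - rewrite <- (RInt_comp_lin (V := R_CompleteNormedModule)) by (apply (ccont_ex_Im h); auto).
    apply RInt_ext; intros. unfold scal, Im; simpl; unfold mult; simpl. ring.
Qed.

(* Multiplying by the conjugate of the integral makes the integral real and nonnegative, so the real
   bound [Re z <= |z|] suffices. *)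
Lemma CRInt_bound h (g : R -> R) a b : a <= b -> ccont h -> ex_RInt g a b ->
  (forall x, a <= x <= b -> Cmod (h x) <= g x) -> Cmod (CRInt h a b) <= RInt g a b.
Proof.
  intros ab H G B.
  set (I := CRInt h a b).
  destruct (Req_dec (Cmod I) 0) as [z|z].
  { rewrite z. apply RInt_ge_0; auto. intros x hx.
    eapply Rle_trans; [apply Cmod_ge_0|apply B; lra]. }
  assert (p : 0 < Cmod I) by (pose proof (Cmod_ge_0 I); lra).
  assert (E : Cmod I * Cmod I = RInt (fun x => Re (Cconj I * h x)%C) a b).
  { change (RInt (fun x => Re (Cconj I * h x)%C) a b) with (Re (CRInt (fun x => (Cconj I * h x)%C) a b)).
    rewrite CRInt_scal by auto. fold I.
    replace (Cmod I * Cmod I) with (Cmod I ^ 2) by ring.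
    rewrite Cmod2_alt. unfold Cconj; simpl. unfold Re, Im. ring. }
  assert (Hc : ccont (fun x => (Cconj I * h x)%C)) by (apply ccont_mult; [apply ccont_const|auto]).
  apply Rmult_le_reg_l with (Cmod I); auto. rewrite E.
  transitivity (RInt (fun x => Cmod I * g x) a b).
  - apply RInt_le; auto.
    + apply (ex_RInt_scal (V := R_CompleteNormedModule) g a b (Cmod I)); auto.
    + intros x hx. eapply Rle_trans; [apply Rle_abs|].
      eapply Rle_trans; [apply re_le_Cmod|].
      rewrite Cmod_mult, Cmod_conj. apply Rmult_le_compat_l; [lra|]. apply B; lra.
  - right. apply (RInt_scal (V := R_CompleteNormedModule) g a b (Cmod I)); auto.
Qed.

Lemma CRInt_bound_const h M a b : a <= b -> ccont h ->
  (forall x, a <= x <= b -> Cmod (h x) <= M) -> Cmod (CRInt h a b) <= M * (b - a).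
Proof.
  intros ab H B. eapply Rle_trans; [apply (CRInt_bound h (fun _ => M)); auto|].
  - apply ex_RInt_const.
  - rewrite RInt_const. unfold scal; simpl; unfold mult; simpl. lra.
Qed.

Lemma RInt_atan B a b : is_RInt (fun x => B / (1 + x * x)) a b (B * (atan b - atan a)).
Proof.
  replace (B * (atan b - atan a)) with (minus (B * atan b) (B * atan a))
    by (unfold minus, plus, opp; simpl; ring).
  apply (is_RInt_derive (V := R_CompleteNormedModule) (fun x => B * atan x)).
  - intros x _. assert (1 + x * x <> 0) by nra.
    auto_derive; [trivial|]. unfold Rsqr. field. simpl; nra.
  - intros x _. apply (ex_derive_continuous (K := R_AbsRing) (V := R_NormedModule)).
    auto_derive. nra.
Qed.

Lemma CRInt_atan_bound h B a b : a <= b -> ccont h ->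
  (forall x, a <= x <= b -> Cmod (h x) <= B / (1 + x * x)) ->
  Cmod (CRInt h a b) <= B * (atan b - atan a).
Proof.
  intros ab H K. rewrite <- (is_RInt_unique _ _ _ _ (RInt_atan B a b)).
  apply CRInt_bound; auto. eexists; apply RInt_atan.
Qed.

(** The eps/3 argument. The approximant may depend on [A] and [eps], so partial sums and truncated
    integrals can be plugged in without forming a sequence. *)
Lemma ccont_lim F :
  (forall A eps, 0 < A -> 0 < eps ->
     exists h, ccont h /\ forall x, Rabs x <= A -> Cmod (F x - h x)%C <= eps) -> ccont F.
Proof.
  intros H x0.
  assert (G : forall (p : C -> R), (forall z w, Rabs (p z - p w) <= Cmod (z - w)%C) ->
     (forall h, ccont h -> forall x, continuous (fun y => p (h y)) x) ->
     continuous (fun y => p (F y)) x0).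
  { intros p Lp Cp. apply filterlim_locally. intros eps.
    assert (e3 : 0 < eps / 3) by (pose proof (cond_pos eps); lra).
    destruct (H (Rabs x0 + 1) (eps / 3)) as [h [hc hb]]; auto.
    { pose proof (Rabs_pos x0); lra. }
    pose proof (proj1 (filterlim_locally _ _) (Cp h hc x0) (mkposreal _ e3)) as L.
    pose proof (locally_ball x0 (mkposreal 1 Rlt_0_1)) as L1.
    generalize (filter_and _ _ L L1). apply filter_imp.
    intros y [b1 b2]. unfold ball in *; simpl in *. unfold AbsRing_ball, abs, minus, plus, opp in *; simpl in *.
    assert (hy : Rabs y <= Rabs x0 + 1).
    { replace y with (x0 + (y + - x0)) by ring. eapply Rle_trans; [apply Rabs_triang|]. lra. }
    assert (hx : Rabs x0 <= Rabs x0 + 1) by lra.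
    pose proof (Rle_trans _ _ _ (Lp (F y) (h y)) (hb y hy)).
    pose proof (Rle_trans _ _ _ (Lp (F x0) (h x0)) (hb x0 hx)).
    revert b1 H0 H1. unfold Rabs; repeat destruct Rcase_abs; lra. }
  split; apply G.
  - intros z w. change (Re z - Re w) with (Re (z - w)%C). apply re_le_Cmod.
  - intros h hc x; exact (proj1 (hc x)).
  - intros z w. change (Im z - Im w) with (Im (z - w)%C). apply Im_le_Cmod.
  - intros h hc x; exact (proj2 (hc x)).
Qed.

(** Passing to the limit in [h x = h 0 + CRInt h' 0 x] gives the same identity for [F] and [D]; as
    [D] is continuous, it can be differentiated. *)
Lemma cderiv_lim F D :
  (forall A eps, 0 < A -> 0 < eps -> exists h h', cderiv h h' /\ ccont h' /\
     forall x, Rabs x <= A -> Cmod (F x - h x)%C <= eps /\ Cmod (D x - h' x)%C <= eps) ->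
  cderiv F D /\ ccont D.
Proof.
  intros H.
  assert (CD : ccont D).
  { apply ccont_lim. intros A eps hA he. destruct (H A eps hA he) as [h [h' [_ [c b]]]].
    exists h'; split; auto. intros x hx; apply (b x hx). }
  split; auto.
  assert (E : forall x, F x = (F 0 + CRInt D 0 x)%C).
  { intros x. apply Cmod_small_eq. intros eps he.
    set (A := Rabs x + 1). assert (hA : 0 < A) by (pose proof (Rabs_pos x); unfold A; lra).
    (* Three errors occur: one at [x] and one at 0, each at most [e'], and [e'] times the length of
       the interval of integration, which is at most [A]. *)
    set (e' := eps / (2 + A)).
    assert (he' : 0 < e') by (apply Rdiv_lt_0_compat; lra).
    destruct (H A e' hA he') as [h [h' [d [c b]]]].
    assert (I1 := CRInt_FTC h h' 0 x d c).
    assert (b0 := proj1 (b 0 ltac:(rewrite Rabs_R0; lra))).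
    assert (bx := proj1 (b x ltac:(unfold A; lra))).
    assert (bi : Cmod (CRInt (fun y => (D y - h' y)%C) 0 x) <= e' * A).
    { assert (cc : ccont (fun y => (D y - h' y)%C)) by (apply ccont_minus; auto).
      destruct (Rle_lt_dec 0 x) as [p|p].
      - eapply Rle_trans; [apply (CRInt_bound_const _ e'); auto|].
        + intros y hy; apply b. unfold A. rewrite !Rabs_pos_eq; lra.
        + apply Rmult_le_compat_l; [lra|]. unfold A. rewrite Rabs_pos_eq; lra.
      - rewrite CRInt_swap, Cmod_opp by auto.
        eapply Rle_trans; [apply (CRInt_bound_const _ e'); auto; [lra|]|].
        + intros y hy; apply b. unfold A. rewrite !Rabs_left1; lra.
        + apply Rmult_le_compat_l; [lra|]. unfold A. rewrite Rabs_left1; lra. }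
    rewrite CRInt_minus, I1 in bi by auto.
    replace (F x - (F 0 + CRInt D 0 x))%C with
      ((F x - h x) - ((F 0 - h 0) + (CRInt D 0 x - (h x - h 0))))%C by ring.
    eapply Rle_trans; [apply Cmod_triangle|]. rewrite Cmod_opp.
    eapply Rle_trans; [apply Rplus_le_compat_l, Cmod_triangle|].
    replace eps with (e' + (e' + e' * A)) by (unfold e'; field; lra). lra. }
  eapply cderiv_ext; [intros x; symmetry; apply E| |apply cderiv_plus; [apply (cderiv_const (F 0))|apply (cderiv_CRInt D 0 CD)]].
  intros; simpl. ring.
Qed.

(** * Exponentials and two-sided series *)

Definition cis (t : R) : C := (cos t, sin t).
Definition cexp (l : C) (x : R) : C := (RtoC (exp (Re l * x)) * cis (Im l * x)%R)%C.

Lemma cis_plus s t : cis (s + t) = (cis s * cis t)%C.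
Proof. apply C_ext; simpl; [apply cos_plus|rewrite sin_plus; ring]. Qed.

Lemma cis_0 : cis 0 = RtoC 1.
Proof. apply C_ext; simpl; [apply cos_0|apply sin_0]. Qed.

Lemma Cmod_cis t : Cmod (cis t) = 1.
Proof.
  unfold Cmod, cis; simpl. replace (_ + _) with 1; [apply sqrt_1|].
  pose proof (sin2_cos2 t). unfold Rsqr in H. lra.
Qed.

Lemma cexpmi_cis t : cexpmi t = cis (- t).
Proof. unfold cexpmi, cis. rewrite cos_neg, sin_neg. reflexivity. Qed.

Lemma cis_2PI_Z t (k : Z) : cis (t + 2 * PI * IZR k) = cis t.
Proof.
  assert (P : forall (s : R) (n : nat), cis (s + 2 * PI * INR n) = cis s).
  { intros s n. unfold cis. replace (s + 2 * PI * INR n) with (s + 2 * INR n * PI) by ring.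
    rewrite cos_period, sin_period. reflexivity. }
  destruct (Z_le_gt_dec 0 k) as [h|h].
  - rewrite <- (Z2Nat.id k h), <- INR_IZR_INZ. apply P.
  - replace k with (- Z.of_nat (Z.to_nat (- k)))%Z by (rewrite Z2Nat.id; lia).
    rewrite opp_IZR, <- INR_IZR_INZ.
    rewrite <- (P (t + 2 * PI * - INR (Z.to_nat (- k))) (Z.to_nat (- k))). f_equal. ring.
Qed.

Lemma cderiv_cis (a b : R) : cderiv (fun x => cis (a * x + b)) (fun x => (Ci * RtoC a * cis (a * x + b)%R)%C).
Proof.
  intros x; split; unfold cis, Re, Im; simpl; auto_derive; trivial; ring.
Qed.

Lemma cderiv_cexp l : cderiv (cexp l) (fun x => (l * cexp l x)%C).
Proof.
  intros x; split; unfold cexp, cis, Re, Im; simpl; auto_derive; trivial; ring.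
Qed.

Lemma ccont_cexp l : ccont (cexp l).
Proof. eapply cderiv_ccont, cderiv_cexp. Qed.

Lemma cexp_plus l x y : cexp l (x + y) = (cexp l x * cexp l y)%C.
Proof.
  unfold cexp. rewrite !Rmult_plus_distr_l, cis_plus, exp_plus, RtoC_mult. ring.
Qed.

Lemma cexp_0 l : cexp l 0 = RtoC 1.
Proof. unfold cexp. rewrite !Rmult_0_r, exp_0, cis_0. ring. Qed.

Lemma cexp_opp l x : (cexp l (- x) * cexp l x)%C = RtoC 1.
Proof. rewrite <- cexp_plus. replace (- x + x) with 0 by ring. apply cexp_0. Qed.

Lemma Cmod_cexp l x : Cmod (cexp l x) = exp (Re l * x).
Proof.
  unfold cexp. rewrite Cmod_mult, Cmod_cis, Cmod_R, Rabs_pos_eq; [ring|left; apply exp_pos].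
Qed.

(** A total function built from extended real limits; it denotes the limit only under a Cauchy bound
    such as that of [clim_bound]. *)
Definition clim (a : nat -> C) : C :=
  (real (Lim_seq (fun n => Re (a n))), real (Lim_seq (fun n => Im (a n)))).

(** The Cauchy rate survives in the limit with the same [e n]; this makes the bounds for series and
    improper integrals explicit. *)
Lemma clim_bound (a : nat -> C) (e : nat -> R) : is_lim_seq e 0 ->
  (forall n m, (n <= m)%nat -> Cmod (a m - a n)%C <= e n) ->
  forall n, Cmod (clim a - a n)%C <= e n.
Proof.
  intros He H n.
  assert (He' : forall eps, 0 < eps -> exists N, forall m, (N <= m)%nat -> e m < eps).
  { intros eps he. apply is_lim_seq_spec in He.
    destruct (He (mkposreal eps he)) as [N hN]. exists N. intros m hm.
    specialize (hN m hm). simpl in hN. rewrite Rminus_0_r in hN.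
    eapply Rle_lt_trans; [apply Rle_abs|exact hN]. }
  assert (G : forall p : C -> R, (forall z w, Rabs (p z - p w) <= Cmod (z - w)%C) ->
     is_lim_seq (fun n => p (a n)) (real (Lim_seq (fun n => p (a n))))).
  { intros p Lp. apply (Lim_seq_correct' (fun n => p (a n))), ex_lim_seq_cauchy_corr. intros eps.
    destruct (He' eps (cond_pos eps)) as [N hN]. exists N. intros i j hi hj.
    destruct (Nat.le_ge_cases i j) as [h|h].
    - rewrite Rabs_minus_sym. eapply Rle_lt_trans; [apply Lp|]. eapply Rle_lt_trans; [apply H, h|apply hN; auto].
    - eapply Rle_lt_trans; [apply Lp|]. eapply Rle_lt_trans; [apply H, h|apply hN; auto]. }
  assert (GR := G Re (fun z w => re_le_Cmod (z - w)%C)).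
  assert (GI := G Im (fun z w => Im_le_Cmod (z - w)%C)).
  apply Cmod_le_eps. intros eps he.
  assert (he2 : 0 < eps / 2) by lra.
  apply is_lim_seq_spec in GR. apply is_lim_seq_spec in GI.
  destruct (GR (mkposreal _ he2)) as [N1 h1], (GI (mkposreal _ he2)) as [N2 h2]. simpl in h1, h2.
  set (m := (n + N1 + N2)%nat).
  exists (a m - a n)%C. split; [|apply H; unfold m; lia].
  replace (clim a - a n - (a m - a n))%C with (clim a - a m)%C by ring.
  eapply Rle_trans; [apply Cmod_le_sum|].
  specialize (h1 m ltac:(unfold m; lia)). specialize (h2 m ltac:(unfold m; lia)).
  change (Re (clim a - a m)%C) with (real (Lim_seq (fun n => Re (a n))) - Re (a m)).
  change (Im (clim a - a m)%C) with (real (Lim_seq (fun n => Im (a n))) - Im (a m)).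
  rewrite Rabs_minus_sym in h1. rewrite Rabs_minus_sym in h2. lra.
Qed.

(* The sum over [- N <= k < N]. *)
Fixpoint zsum (a : Z -> C) (N : nat) : C :=
  match N with
  | O => RtoC 0
  | S n => (zsum a n + (a (Z.of_nat n) + a (- Z.of_nat n - 1)%Z))%C
  end.
Definition zlim (a : Z -> C) : C := clim (zsum a).
(** With this fixed majorant the rate of convergence depends on [B] alone, so a common [B] yields
    uniform convergence. *)
Definition summable (B : R) (a : Z -> C) : Prop :=
  forall k : Z, Cmod (a k) <= B / (1 + IZR k * IZR k).

Lemma one_sqr_pos x : 0 < 1 + x * x.
Proof. nra. Qed.

Lemma div_le_l a b c : 0 < c -> (a / c <= b <-> a <= b * c).
Proof.
  intros hc. split; intros h.
  - replace a with (a / c * c) by (field; lra). apply Rmult_le_compat_r; lra.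
  - apply Rmult_le_reg_r with c; auto. replace (a / c * c) with a by (field; lra). lra.
Qed.

Lemma div_le_r a b c : 0 < c -> (b <= a / c <-> b * c <= a).
Proof.
  intros hc. split; intros h.
  - replace a with (a / c * c) by (field; lra). apply Rmult_le_compat_r; lra.
  - apply Rmult_le_reg_r with c; auto. replace (a / c * c) with a by (field; lra). lra.
Qed.

Lemma summable_pos B a : summable B a -> 0 <= B.
Proof.
  intros H. specialize (H 0%Z). pose proof (Cmod_ge_0 (a 0%Z)).
  simpl in H. replace (B / (1 + 0 * 0)) with B in H by field. lra.
Qed.

(** Both terms added at step [m] have index of modulus at least [m], and [1 / (1 + x^2) <= 4 (1 / (x
    + 1) - 1 / (x + 2))] because [(x + 1) (x + 2) <= 4 (1 + x^2)]. Two such terms give the factor 8,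
    and the sum telescopes. *)
Lemma zsum_tail B a : summable B a -> forall n m, (n <= m)%nat ->
  Cmod (zsum a m - zsum a n)%C <= 8 * B * (/ (INR n + 1) - / (INR m + 1)).
Proof.
  intros H n m h. pose proof (summable_pos B a H) as hB. induction h as [|m h IH].
  - replace (zsum a n - zsum a n)%C with (RtoC 0) by ring. rewrite Cmod_0. lra.
  - simpl zsum.
    replace (zsum a m + (a (Z.of_nat m) + a (- Z.of_nat m - 1)%Z) - zsum a n)%C with
      ((zsum a m - zsum a n) + (a (Z.of_nat m) + a (- Z.of_nat m - 1)%Z))%C by ring.
    eapply Rle_trans; [apply Cmod_triangle|].
    assert (E : Cmod (a (Z.of_nat m) + a (- Z.of_nat m - 1)%Z)%C <=
      8 * B * (/ (INR m + 1) - / (INR m + 2))).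
    { eapply Rle_trans; [apply Cmod_triangle|].
      pose proof (pos_INR m) as pm. set (x := INR m) in *.
      assert (K : forall k, IZR k * IZR k >= x * x -> Cmod (a k) <= 4 * B * (/ (x + 1) - / (x + 2))).
      { intros k hk. eapply Rle_trans; [apply H|].
        replace (4 * B * (/ (x + 1) - / (x + 2))) with (4 * B / ((x + 1) * (x + 2))) by (field; lra).
        apply div_le_l; [nra|].
        replace (4 * B / ((x + 1) * (x + 2)) * (1 + IZR k * IZR k)) with
          (4 * B * (1 + IZR k * IZR k) / ((x + 1) * (x + 2))) by (field; lra).
        apply div_le_r; [nra|].
        replace (4 * B * (1 + IZR k * IZR k)) with (B * (4 * (1 + IZR k * IZR k))) by ring.
        apply Rmult_le_compat_l; auto. nra. }
      assert (K1 := K (Z.of_nat m)). assert (K2 := K (- Z.of_nat m - 1)%Z).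
      rewrite minus_IZR, opp_IZR in K2. rewrite <- INR_IZR_INZ in K1, K2. fold x in K1, K2.
      specialize (K1 ltac:(nra)). specialize (K2 ltac:(nra)). lra. }
    rewrite S_INR. replace (INR m + 1 + 1) with (INR m + 2) by ring. lra.
Qed.

Lemma lim_inv_succ c : is_lim_seq (fun n => c / (INR n + 1)) 0.
Proof.
  replace (Finite 0) with (Rbar_mult c 0) by (simpl; f_equal; ring).
  apply is_lim_seq_scal_l.
  apply (is_lim_seq_ext (fun n => / INR (S n))).
  - intros n. rewrite S_INR. reflexivity.
  - apply (is_lim_seq_incr_1 (fun n => / INR n)).
    replace (Finite 0) with (Rbar_inv p_infty) by reflexivity.
    apply is_lim_seq_inv; [apply is_lim_seq_INR|discriminate].
Qed.

Lemma zlim_bound B a : summable B a -> forall N, Cmod (zlim a - zsum a N)%C <= 8 * B / (INR N + 1).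
Proof.
  intros H. apply clim_bound; [apply lim_inv_succ|].
  intros n m h. eapply Rle_trans; [apply (zsum_tail B a H n m h)|].
  pose proof (summable_pos B a H). unfold Rdiv. apply Rmult_le_compat_l; [lra|].
  assert (0 < / (INR m + 1)) by (apply Rinv_0_lt_compat; pose proof (pos_INR m); lra). lra.
Qed.

Lemma zlim_norm B a : summable B a -> Cmod (zlim a) <= 8 * B.
Proof.
  intros H. generalize (zlim_bound B a H 0). simpl.
  replace (8 * B / (0 + 1)) with (8 * B) by field.
  replace (zlim a - RtoC 0)%C with (zlim a) by ring. auto.
Qed.

Lemma inv_succ_small c eps : 0 < eps -> exists N, forall n, (N <= n)%nat -> c / (INR n + 1) <= eps.
Proof.
  intros he. pose proof (lim_inv_succ c) as L. apply is_lim_seq_spec in L.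
  destruct (L (mkposreal eps he)) as [N hN]. exists N. intros n hn. specialize (hN n hn).
  simpl in hN. rewrite Rminus_0_r in hN. left. eapply Rle_lt_trans; [apply Rle_abs|exact hN].
Qed.

Lemma zlim_unique B a l : summable B a ->
  (forall eps, 0 < eps -> exists N0, forall N, (N0 <= N)%nat -> Cmod (l - zsum a N)%C <= eps) ->
  zlim a = l.
Proof.
  intros H K. apply Cmod_small_eq. intros eps he.
  destruct (K (eps / 2) ltac:(lra)) as [N1 h1].
  destruct (inv_succ_small (8 * B) (eps / 2) ltac:(lra)) as [N2 h2].
  set (N := (N1 + N2)%nat).
  replace (zlim a - l)%C with ((zlim a - zsum a N) - (l - zsum a N))%C by ring.
  eapply Rle_trans; [apply Cmod_triangle|]. rewrite Cmod_opp.
  pose proof (zlim_bound B a H N). specialize (h1 N ltac:(unfold N; lia)).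
  specialize (h2 N ltac:(unfold N; lia)). lra.
Qed.

Lemma zsum_ext a b N : (forall k, a k = b k) -> zsum a N = zsum b N.
Proof. intros E; induction N as [|n IH]; simpl; [reflexivity|rewrite IH, !E; reflexivity]. Qed.

Lemma zlim_ext a b : (forall k, a k = b k) -> zlim a = zlim b.
Proof. intros E. f_equal. apply functional_extensionality; exact E. Qed.

Lemma zsum_plus a b N : zsum (fun k => (a k + b k)%C) N = (zsum a N + zsum b N)%C.
Proof. induction N as [|n IH]; simpl; [|rewrite IH]; ring. Qed.

Lemma zsum_scal c a N : zsum (fun k => (c * a k)%C) N = (c * zsum a N)%C.
Proof. induction N as [|n IH]; simpl; [|rewrite IH]; ring. Qed.

Lemma summable_plus A B a b : summable A a -> summable B b -> summable (A + B) (fun k => (a k + b k)%C).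
Proof.
  intros H K k. eapply Rle_trans; [apply Cmod_triangle|].
  unfold Rdiv. rewrite Rmult_plus_distr_r. apply Rplus_le_compat; [apply H|apply K].
Qed.

Lemma summable_scal A a c : summable A a -> summable (Cmod c * A) (fun k => (c * a k)%C).
Proof.
  intros H k. rewrite Cmod_mult. unfold Rdiv. rewrite Rmult_assoc.
  apply Rmult_le_compat_l; [apply Cmod_ge_0|apply H].
Qed.

Lemma zlim_plus A B a b : summable A a -> summable B b ->
  zlim (fun k => (a k + b k)%C) = (zlim a + zlim b)%C.
Proof.
  intros H K. apply (zlim_unique (A + B)); [apply summable_plus; auto|].
  intros eps he.
  destruct (inv_succ_small (8 * A) (eps / 2) ltac:(lra)) as [N1 h1].
  destruct (inv_succ_small (8 * B) (eps / 2) ltac:(lra)) as [N2 h2].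
  exists (N1 + N2)%nat. intros N hN. rewrite zsum_plus.
  replace (zlim a + zlim b - (zsum a N + zsum b N))%C with
    ((zlim a - zsum a N) + (zlim b - zsum b N))%C by ring.
  eapply Rle_trans; [apply Cmod_triangle|].
  pose proof (zlim_bound A a H N). pose proof (zlim_bound B b K N).
  specialize (h1 N ltac:(lia)). specialize (h2 N ltac:(lia)). lra.
Qed.

Lemma zlim_scal A a c : summable A a -> zlim (fun k => (c * a k)%C) = (c * zlim a)%C.
Proof.
  intros H. apply (zlim_unique (Cmod c * A)); [apply summable_scal; auto|].
  intros eps he.
  destruct (inv_succ_small (Cmod c * (8 * A)) eps he) as [N1 h1].
  exists N1. intros N hN. rewrite zsum_scal.
  replace (c * zlim a - c * zsum a N)%C with (c * (zlim a - zsum a N))%C by ring.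
  rewrite Cmod_mult. eapply Rle_trans; [|apply (h1 N hN)].
  unfold Rdiv. rewrite Rmult_assoc. apply Rmult_le_compat_l; [apply Cmod_ge_0|apply (zlim_bound A a H N)].
Qed.

(** The hypothesis of a Weierstrass test on compact intervals: one constant [B] serves all [x] in
    [[-A, A]]. *)
Definition locsum (phi : Z -> R -> C) : Prop :=
  forall A, 0 < A -> exists B, forall x, Rabs x <= A -> summable B (fun k => phi k x).

Lemma zsum_ccont phi N : (forall k, ccont (phi k)) -> ccont (fun x => zsum (fun k => phi k x) N).
Proof.
  intros H. induction N as [|n IH]; simpl; [apply ccont_const|].
  apply ccont_plus; [exact IH|apply ccont_plus; apply H].
Qed.

Lemma zsum_cderiv phi phi' N : (forall k, cderiv (phi k) (phi' k)) ->
  cderiv (fun x => zsum (fun k => phi k x) N) (fun x => zsum (fun k => phi' k x) N).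
Proof.
  intros H. induction N as [|n IH]; simpl; [apply cderiv_const|].
  apply cderiv_plus; [exact IH|apply cderiv_plus; apply H].
Qed.

Lemma zsum_CRInt phi N a b : (forall k, ccont (phi k)) ->
  CRInt (fun x => zsum (fun k => phi k x) N) a b = zsum (fun k => CRInt (phi k) a b) N.
Proof.
  intros H. induction N as [|n IH]; simpl; [apply CRInt_zero|].
  rewrite CRInt_plus; [|apply zsum_ccont; auto|apply ccont_plus; auto].
  rewrite IH, CRInt_plus by auto. reflexivity.
Qed.

Lemma zlim_ccont phi : locsum phi -> (forall k, ccont (phi k)) -> ccont (fun x => zlim (fun k => phi k x)).
Proof.
  intros L H. apply ccont_lim. intros A eps hA he. destruct (L A hA) as [B hB].
  destruct (inv_succ_small (8 * B) eps he) as [N hN].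
  exists (fun x => zsum (fun k => phi k x) N). split; [apply zsum_ccont; auto|].
  intros x hx. eapply Rle_trans; [apply (zlim_bound B _ (hB x hx) N)|]. apply hN; lia.
Qed.

Lemma zlim_cderiv phi phi' : locsum phi -> locsum phi' -> (forall k, cderiv (phi k) (phi' k)) ->
  (forall k, ccont (phi' k)) ->
  cderiv (fun x => zlim (fun k => phi k x)) (fun x => zlim (fun k => phi' k x)).
Proof.
  intros L L' H H'. apply cderiv_lim. intros A eps hA he.
  destruct (L A hA) as [B hB], (L' A hA) as [B' hB'].
  destruct (inv_succ_small (8 * B) eps he) as [N hN], (inv_succ_small (8 * B') eps he) as [N' hN'].
  exists (fun x => zsum (fun k => phi k x) (N + N')), (fun x => zsum (fun k => phi' k x) (N + N')).
  split; [apply zsum_cderiv; auto|]. split; [apply zsum_ccont; auto|].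
  intros x hx; split.
  - eapply Rle_trans; [apply (zlim_bound B _ (hB x hx))|]. apply hN; lia.
  - eapply Rle_trans; [apply (zlim_bound B' _ (hB' x hx))|]. apply hN'; lia.
Qed.

Lemma locsum_CRInt phi a b : a <= b -> locsum phi -> (forall k, ccont (phi k)) ->
  exists B, summable B (fun k => CRInt (phi k) a b).
Proof.
  intros ab L H. destruct (L (Rabs a + Rabs b + 1)) as [B hB].
  { pose proof (Rabs_pos a); pose proof (Rabs_pos b); lra. }
  exists (B * (b - a)). intros k.
  eapply Rle_trans; [apply (CRInt_bound_const _ (B / (1 + IZR k * IZR k))); auto|].
  - intros x hx. apply hB. unfold Rabs; repeat destruct Rcase_abs; lra.
  - right; field. pose proof (one_sqr_pos (IZR k)); lra.
Qed.

Lemma zlim_CRInt phi a b : a <= b -> locsum phi -> (forall k, ccont (phi k)) ->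
  CRInt (fun x => zlim (fun k => phi k x)) a b = zlim (fun k => CRInt (phi k) a b).
Proof.
  intros ab L H. destruct (L (Rabs a + Rabs b + 1)) as [B hB].
  { pose proof (Rabs_pos a); pose proof (Rabs_pos b); lra. }
  assert (hB' : forall x, a <= x <= b -> summable B (fun k => phi k x)).
  { intros x hx. apply hB. unfold Rabs; repeat destruct Rcase_abs; lra. }
  destruct (locsum_CRInt phi a b ab L H) as [B1 h1].
  symmetry. apply (zlim_unique B1); [exact h1|].
    intros eps he. destruct (inv_succ_small (8 * B * (b - a)) eps he) as [N0 hN].
    exists N0. intros N h. rewrite <- zsum_CRInt, <- CRInt_minus; auto;
      [|apply zlim_ccont; auto|apply zsum_ccont; auto].
    eapply Rle_trans; [apply (CRInt_bound_const _ (8 * B / (INR N + 1))); auto|].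
    + apply ccont_minus; [apply zlim_ccont; auto|apply zsum_ccont; auto].
    + intros x hx. apply zlim_bound; auto.
    + eapply Rle_trans; [|apply (hN N h)]. right; field. pose proof (pos_INR N); lra.
Qed.

(** * Uniqueness for Fourier series *)

(* The powers of [(1 + cos s) / 2] concentrate at [s = 0]. *)
Lemma cos_kernel_concentrates (g : R -> R) (t0 : R) :
  (forall t, continuous g t) -> 0 < g t0 ->
  ~ (forall N : nat, RInt (fun t => g t * ((1 + cos (t - t0)) / 2) ^ N) (t0 - PI) (t0 + PI) = 0).
Proof.
  intros Cg ga HN. set (a := g t0) in *.
  pose proof PI_RGT_0 as pi0.
  assert (ha2 : 0 < a / 2) by lra.
  destruct (proj1 (filterlim_locally _ _) (Cg t0) (mkposreal _ ha2)) as [d0 hd0].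
  (* [d < d0] keeps [g] above [a / 2] within distance [d]; [d <= PI / 2] makes [q1] positive. *)
  set (d := Rmin (d0 / 2) (PI / 2)).
  assert (d0p := cond_pos d0).
  assert (dp : 0 < d) by (unfold d; apply Rmin_glb_lt; lra).
  assert (dd0 : d < d0) by (unfold d; eapply Rle_lt_trans; [apply Rmin_l|lra]).
  assert (dpi : d <= PI / 2) by (unfold d; apply Rmin_r).
  assert (near : forall t, Rabs (t - t0) <= d -> a / 2 <= g t).
  { intros t ht. assert (B := hd0 t). unfold ball in B; simpl in B.
    unfold AbsRing_ball, abs, minus, plus, opp in B; simpl in B.
    fold a in B. specialize (B (Rle_lt_trans _ _ _ ht dd0)). revert B. unfold Rabs; destruct Rcase_abs; lra. }
  set (K := fun t => (1 + cos (t - t0)) / 2).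
  (* The kernel is at most [q1] beyond distance [d] and at least [q2] within distance [d / 2]; the
     gap [q1 < q2] becomes decisive in [N]-th powers. *)
  set (q1 := (1 + cos d) / 2). set (q2 := (1 + cos (d / 2)) / 2).
  assert (hq1 : 0 < q1).
  { unfold q1. assert (0 <= cos d) by (apply cos_ge_0; lra). lra. }
  assert (hq12 : q1 < q2).
  { unfold q1, q2. assert (cos d < cos (d / 2)) by (apply cos_decreasing_1; lra). lra. }
  assert (K0 : forall t, 0 <= K t).
  { intros t. unfold K. pose proof (COS_bound (t - t0)). lra. }
  assert (Kabs : forall t, K t = (1 + cos (Rabs (t - t0))) / 2).
  { intros t. unfold K, Rabs. destruct Rcase_abs; [rewrite cos_neg|]; reflexivity. }
  assert (Kfar : forall t, d <= Rabs (t - t0) <= PI -> K t <= q1).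
  { intros t ht. rewrite Kabs. unfold q1.
    assert (cos (Rabs (t - t0)) <= cos d) by (apply cos_decr_1; lra). lra. }
  assert (Knear : forall t, Rabs (t - t0) <= d / 2 -> q2 <= K t).
  { intros t ht. rewrite Kabs. unfold q2. pose proof (Rabs_pos (t - t0)).
    assert (cos (d / 2) <= cos (Rabs (t - t0))) by (apply cos_decr_1; lra). lra. }
  assert (Mex : exists M, 0 <= M /\ forall t, t0 - PI <= t <= t0 + PI -> Rabs (g t) <= M).
  { destruct (continuity_ab_maj (fun t => Rabs (g t)) (t0 - PI) (t0 + PI)) as [m [hm _]]; [lra| |].
    - intros c _. apply (continuity_pt_comp g Rabs).
      + apply continuity_pt_filterlim, Cg.
      + apply Rcontinuity_abs.
    - exists (Rabs (g m)). split; [apply Rabs_pos|exact hm]. }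
  destruct Mex as [M [M0 hM]].
  assert (Kc : forall t, continuous K t).
  { intros t. apply (ex_derive_continuous (K := R_AbsRing) (V := R_NormedModule)).
    unfold K. auto_derive. trivial. }
  (* Within distance [d] the integrand is nonnegative, so only the far region can contribute
     negatively. *)
  assert (far : forall N t, t0 - PI <= t <= t0 + PI -> - (M * q1 ^ N) <= g t * K t ^ N).
  { intros N t ht. assert (0 <= K t ^ N) by (apply pow_le, K0).
    assert (0 <= q1 ^ N) by (apply pow_le; lra).
    destruct (Rle_lt_dec (Rabs (t - t0)) d) as [h|h].
    - assert (0 <= g t) by (generalize (near t h); lra). nra.
    - assert (K t ^ N <= q1 ^ N).
      { apply pow_incr. split; [apply K0|apply Kfar]. split; [lra|]. apply Rabs_le; lra. }
      assert (Rabs (g t * K t ^ N) <= M * q1 ^ N).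
      { rewrite Rabs_mult, (Rabs_pos_eq (K t ^ N)) by auto.
        apply Rmult_le_compat; auto using Rabs_pos. }
      revert H2. unfold Rabs; destruct Rcase_abs; lra. }
  assert (close : forall N t, Rabs (t - t0) <= d / 2 -> a / 2 * q2 ^ N <= g t * K t ^ N).
  { intros N t ht. apply Rmult_le_compat; [lra|apply pow_le; lra|apply near; lra|].
    apply pow_incr. split; [lra|apply Knear; auto]. }
  (* If the integral vanishes, the gain on the central interval of length [d] is at most the loss
     outside, over a length at most [2 * PI]. The decay of [(q1 / q2) ^ N] contradicts this for
     large [N]. *)
  assert (key : forall N : nat, a / 2 * d * q2 ^ N <= 2 * PI * M * q1 ^ N).
  { intros N. specialize (HN N). fold K in HN.
    set (F := fun t => g t * K t ^ N) in *.
    assert (Fc : forall u v, ex_RInt F u v).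
    { intros u v. apply (ex_RInt_continuous (V := R_CompleteNormedModule)). intros z _.
      apply (continuous_mult (K := R_AbsRing) g (fun t => K t ^ N)); [apply Cg|].
      apply (continuous_comp K (fun y => y ^ N)); [apply Kc|].
      apply (ex_derive_continuous (K := R_AbsRing) (V := R_NormedModule)). auto_derive. trivial. }
    change (RInt F (t0 - PI) (t0 + PI) = 0) in HN.
    rewrite <- (RInt_Chasles (V := R_CompleteNormedModule) F _ (t0 - d / 2) _) in HN by auto.
    rewrite <- (RInt_Chasles (V := R_CompleteNormedModule) F (t0 - d / 2) (t0 + d / 2) (t0 + PI)) in HN by auto.
    unfold plus in HN; simpl in HN.
    assert (L : forall u v c, u <= v -> (forall t, u < t < v -> c <= F t) -> c * (v - u) <= RInt F u v).
    { intros u v c uv hc. replace (c * (v - u)) with (RInt (fun _ => c) u v).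
      - apply RInt_le; auto. apply ex_RInt_const.
      - rewrite RInt_const. unfold scal; simpl; unfold mult; simpl. ring. }
    assert (L1 := L (t0 - PI) (t0 - d / 2) (- (M * q1 ^ N)) ltac:(lra)
       ltac:(intros t ht; apply far; lra)).
    assert (L2 := L (t0 - d / 2) (t0 + d / 2) (a / 2 * q2 ^ N) ltac:(lra)
       ltac:(intros t ht; apply close; apply Rabs_le; lra)).
    assert (L3 := L (t0 + d / 2) (t0 + PI) (- (M * q1 ^ N)) ltac:(lra)
       ltac:(intros t ht; apply far; lra)).
    assert (0 <= M * q1 ^ N) by (apply Rmult_le_pos; [lra|apply pow_le; lra]).
    nra. }
  assert (hy : 0 < a / 2 * d / (2 * PI * M + 1)) by (apply Rdiv_lt_0_compat; nra).
  assert (hx : Rabs (q1 / q2) < 1).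
  { rewrite Rabs_pos_eq; [|left; apply Rdiv_lt_0_compat; lra].
    apply Rmult_lt_reg_r with q2; [lra|]. unfold Rdiv. rewrite Rmult_assoc, Rinv_l; lra. }
  destruct (pow_lt_1_zero _ hx _ hy) as [N hN]. specialize (hN N (le_n N)). specialize (key N).
  assert (q2p : 0 < q2 ^ N) by (apply pow_lt; lra).
  assert (hN1 : (q1 / q2) ^ N < a / 2 * d / (2 * PI * M + 1)) by (eapply Rle_lt_trans; [apply Rle_abs|exact hN]).
  unfold Rdiv at 1 in hN1. rewrite Rpow_mult_distr, pow_inv in hN1.
  assert (hD : 0 < 2 * PI * M + 1) by nra.
  assert (q1p : 0 < q1 ^ N) by (apply pow_lt; lra).
  assert (hN2 : q1 ^ N * (2 * PI * M + 1) < a / 2 * d * q2 ^ N).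
  { apply Rmult_lt_compat_r with (r := q2 ^ N * (2 * PI * M + 1)) in hN1; [|nra].
    replace (q1 ^ N * / q2 ^ N * (q2 ^ N * (2 * PI * M + 1))) with (q1 ^ N * (2 * PI * M + 1)) in hN1
      by (field; lra).
    replace (a / 2 * d / (2 * PI * M + 1) * (q2 ^ N * (2 * PI * M + 1))) with (a / 2 * d * q2 ^ N) in hN1
      by (field; lra). exact hN1. }
  nra.
Qed.

(** The powers of [(1 + cos (t - t0)) / 2] are trigonometric polynomials, so [G] integrates to 0
    against each of them, which a nonzero [G t0] excludes by [cos_kernel_concentrates]. *)
Lemma trig_coefs_zero (G : R -> C) (t0 : R) : ccont G ->
  (forall j : Z, CRInt (fun t => (G t * cis (IZR j * t))%C) (t0 - PI) (t0 + PI) = RtoC 0) ->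
  G t0 = RtoC 0.
Proof.
  intros HG Hj. apply NNPP. intros nz.
  set (K := fun t => (1 + cos (t - t0)) / 2).
  assert (Cc : forall j : Z, ccont (fun t => cis (IZR j * t))).
  { intros j. apply (cderiv_ccont _ (fun t => (Ci * RtoC (IZR j) * cis (IZR j * t + 0)%R)%C)).
    eapply cderiv_ext; [| |apply (cderiv_cis (IZR j) 0)]; intros; simpl; rewrite ?Rplus_0_r; reflexivity. }
  assert (Kc : ccont (fun t => RtoC (K t))).
  { apply ccont_RtoC. intros t. apply (ex_derive_continuous (K := R_AbsRing) (V := R_NormedModule)).
    unfold K. auto_derive. trivial. }
  (* Since [K t = 1/2 + (cis (t - t0) + cis (t0 - t)) / 4], one more factor [K] combines the
     frequencies [j], [j + 1] and [j - 1]; hence the induction carries all [j] at once. *)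
  assert (S : forall N, ccont (fun t => (G t * RtoC (K t ^ N))%C) /\ forall j : Z,
     CRInt (fun t => (G t * RtoC (K t ^ N) * cis (IZR j * t))%C) (t0 - PI) (t0 + PI) = RtoC 0).
  { induction N as [|N [IHc IH]].
    - simpl. split.
      + apply ccont_mult; [auto|apply ccont_const].
      + intros j. rewrite <- (Hj j). apply CRInt_ext. intros x. ring.
    - split.
      + assert (E : (fun t => (G t * RtoC (K t ^ S N))%C) = (fun t => (G t * RtoC (K t ^ N) * RtoC (K t))%C)).
        { apply functional_extensionality. intros t. simpl. rewrite RtoC_mult. ring. }
        rewrite E. apply ccont_mult; auto.
      + intros j.
        set (H := fun (j : Z) t => (G t * RtoC (K t ^ N) * cis (IZR j * t))%C) in *.
        assert (Hc : forall j, ccont (H j)) by (intros; apply ccont_mult; auto).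
        transitivity (CRInt (fun t => (RtoC (/ 2) * H j t + (RtoC (/ 4) * cis (- t0) * H (j + 1)%Z t +
           RtoC (/ 4) * cis t0 * H (j - 1)%Z t))%C) (t0 - PI) (t0 + PI)).
        * apply CRInt_ext. intros t. unfold H.
          rewrite plus_IZR, minus_IZR. simpl pow. rewrite RtoC_mult.
          replace ((IZR j + 1) * t) with (IZR j * t + t) by ring.
          replace ((IZR j - 1) * t) with (IZR j * t + - t) by ring.
          rewrite !cis_plus.
          replace (RtoC (K t)) with (RtoC (/ 2) + RtoC (/ 4) * cis (- t0) * cis t +
             RtoC (/ 4) * cis t0 * cis (- t))%C; [ring|].
          unfold K. rewrite cos_minus.
          apply C_ext; simpl; rewrite !cos_neg, !sin_neg; field.
        * assert (Sc : forall (c : C) h, ccont h -> ccont (fun t => (c * h t)%C))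
            by (intros; apply ccont_mult; [apply ccont_const|auto]).
          assert (E1 := CRInt_plus (fun t => (RtoC (/ 4) * cis (- t0) * H (j + 1)%Z t)%C)
             (fun t => (RtoC (/ 4) * cis t0 * H (j - 1)%Z t)%C) (t0 - PI) (t0 + PI) (Sc _ _ (Hc _)) (Sc _ _ (Hc _))).
          assert (E2 := CRInt_plus (fun t => (RtoC (/ 2) * H j t)%C)
             (fun t => (RtoC (/ 4) * cis (- t0) * H (j + 1)%Z t + RtoC (/ 4) * cis t0 * H (j - 1)%Z t)%C)
             (t0 - PI) (t0 + PI) (Sc _ _ (Hc _)) (ccont_plus _ _ (Sc _ _ (Hc _)) (Sc _ _ (Hc _)))).
          etransitivity; [exact E2|]. rewrite E1.
          rewrite (CRInt_scal _ (H j)), (CRInt_scal _ (H (j + 1)%Z)), (CRInt_scal _ (H (j - 1)%Z)) by apply Hc.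
          unfold H. rewrite !IH. ring. }
  (* Multiplying by the conjugate makes the value at [t0] equal to [|G t0|^2 > 0], as the real
     kernel argument requires. *)
  set (c := Cconj (G t0)).
  apply (cos_kernel_concentrates (fun t => Re (c * G t)%C) t0).
  - assert (Cg : ccont (fun t => (c * G t)%C)) by (apply ccont_mult; [apply ccont_const|auto]).
    intros t. exact (proj1 (Cg t)).
  - unfold c. rewrite Cmult_comm, <- Cmod2_conj. simpl.
    apply Cmod_gt_0 in nz. nra.
  - intros N. destruct (S N) as [Sc Sj]. specialize (Sj 0%Z).
    assert (E : CRInt (fun t => (c * (G t * RtoC (K t ^ N)))%C) (t0 - PI) (t0 + PI) = RtoC 0).
    { rewrite CRInt_scal by auto. replace (RtoC 0) with (c * RtoC 0)%C by ring. f_equal.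
      rewrite <- Sj. apply CRInt_ext. intros t. rewrite Rmult_0_l, cis_0. ring. }
    apply (f_equal Re) in E. simpl in E. rewrite <- E. apply RInt_ext. intros t _.
    fold (K t). simpl. unfold Re. simpl. ring.
Qed.

(** * Functions of two variables *)

Definition ccont2 (g : R -> R -> C) : Prop :=
  forall t x : R, continuous (fun p : R * R => Re (g (fst p) (snd p))) (t, x) /\
                  continuous (fun p : R * R => Im (g (fst p) (snd p))) (t, x).

Lemma cont2_ccont2 g : cont2 g -> ccont2 g.
Proof.
  intros H t x. specialize (H t x). split.
  - apply (continuous_comp (fun p : R * R => g (fst p) (snd p)) (fun z : C => Re z)); [exact H|].
    destruct (g (fst (t, x)) (snd (t, x))) as [u v]. apply (continuous_fst (U := R_UniformSpace) (V := R_UniformSpace)).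
  - apply (continuous_comp (fun p : R * R => g (fst p) (snd p)) (fun z : C => Im z)); [exact H|].
    destruct (g (fst (t, x)) (snd (t, x))) as [u v]. apply (continuous_snd (U := R_UniformSpace) (V := R_UniformSpace)).
Qed.

Lemma ccont2_plus g h : ccont2 g -> ccont2 h -> ccont2 (fun t x => (g t x + h t x)%C).
Proof.
  intros H K t x; destruct (H t x) as [a b], (K t x) as [c d]; split; simpl;
  apply (continuous_plus (V := R_NormedModule)); assumption.
Qed.

Lemma ccont2_mult g h : ccont2 g -> ccont2 h -> ccont2 (fun t x => (g t x * h t x)%C).
Proof.
  intros H K t x; destruct (H t x) as [a b], (K t x) as [c d]; split; simpl.
  - apply (continuous_minus (V := R_NormedModule)); apply (continuous_mult (K := R_AbsRing)); assumption.
  - apply (continuous_plus (V := R_NormedModule)); apply (continuous_mult (K := R_AbsRing)); assumption.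
Qed.

Lemma ccont2_const c : ccont2 (fun _ _ => c).
Proof. intros t x; split; apply continuous_const. Qed.

Lemma ccont2_t h : ccont h -> ccont2 (fun t _ => h t).
Proof.
  intros H t x; split.
  - exact (continuous_comp fst (fun t => Re (h t)) (t, x) (continuous_fst t x) (proj1 (H t))).
  - exact (continuous_comp fst (fun t => Im (h t)) (t, x) (continuous_fst t x) (proj2 (H t))).
Qed.

Lemma ccont2_swap g : ccont2 g -> ccont2 (fun x t => g t x).
Proof.
  intros H x t; split.
  - refine (continuous_comp_2 snd fst (fun t x => Re (g t x)) (x, t) _ _ (proj1 (H t x)));
    [apply continuous_snd|apply continuous_fst].
  - refine (continuous_comp_2 snd fst (fun t x => Im (g t x)) (x, t) _ _ (proj2 (H t x)));
    [apply continuous_snd|apply continuous_fst].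
Qed.

Lemma ccont2_ccont_t g x : ccont2 g -> ccont (fun t => g t x).
Proof.
  intros H t; split.
  - refine (continuous_comp_2 (fun t => t) (fun _ => x) (fun t x => Re (g t x)) t _ _ (proj1 (H t x)));
    [apply continuous_id|apply continuous_const].
  - refine (continuous_comp_2 (fun t => t) (fun _ => x) (fun t x => Im (g t x)) t _ _ (proj2 (H t x)));
    [apply continuous_id|apply continuous_const].
Qed.

Lemma ccont2_ccont_x g t : ccont2 g -> ccont (g t).
Proof. intros H. apply (ccont2_ccont_t (fun x t => g t x) t), ccont2_swap, H. Qed.

Lemma cderiv_CRInt_param (g g' : R -> R -> C) a b :
  (forall t, cderiv (fun x => g t x) (fun x => g' t x)) -> (forall x, ccont (fun t => g t x)) -> ccont2 g' ->
  cderiv (fun x => CRInt (fun t => g t x) a b) (fun x => CRInt (fun t => g' t x) a b).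
Proof.
  intros H Hc H' x.
  assert (G : forall (p : C -> R),
     (forall t x, is_derive (fun x => p (g t x)) x (p (g' t x))) ->
     (forall x, ex_RInt (fun t => p (g t x)) a b) ->
     (forall t x, continuity_2d_pt (fun x t => p (g' t x)) x t) ->
     is_derive (fun x => RInt (fun t => p (g t x)) a b) x (RInt (fun t => p (g' t x)) a b)).
  { intros p P1 P2 P3.
    assert (DE : forall t y, Derive (fun z => p (g t z)) y = p (g' t y)).
    { intros t y. apply is_derive_unique, P1. }
    rewrite (RInt_ext (V := R_CompleteNormedModule) (fun t => p (g' t x)) (fun t => Derive (fun u => p (g t u)) x)).
    - apply (is_derive_RInt_param (fun x t => p (g t x))).
      + apply filter_forall. intros y t _. eexists; apply P1.
      + intros t _. apply (continuity_2d_pt_ext (fun x t => p (g' t x))).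
        * intros u v. symmetry; apply DE.
        * apply P3.
      + apply filter_forall. intros y. apply P2.
    - intros t _. symmetry; apply DE. }
  split.
  - apply (G Re).
    + intros t y; exact (proj1 (H t y)).
    + intros y; exact (ccont_ex_Re (fun t => g t y) a b (Hc y)).
    + intros t y. apply continuity_2d_pt_filterlim. exact (proj1 (ccont2_swap _ H' y t)).
  - apply (G Im).
    + intros t y; exact (proj2 (H t y)).
    + intros y; exact (ccont_ex_Im (fun t => g t y) a b (Hc y)).
    + intros t y. apply continuity_2d_pt_filterlim. exact (proj2 (ccont2_swap _ H' y t)).
Qed.

Lemma cderiv_zero_const h : cderiv h (fun _ => RtoC 0) -> forall x y, h x = h y.
Proof.
  intros H x y. pose proof (CRInt_FTC h _ y x H (ccont_const _)) as E. rewrite CRInt_zero in E.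
  replace (h x) with ((h x - h y) + h y)%C by ring. rewrite <- E. ring.
Qed.

(** As functions of the upper limit [v], both sides vanish at [u] and have the same derivative. The
    partial derivatives [Ft] and [Fx] ensure the continuity of the inner integrals. *)
Lemma CRInt_Fubini (F Ft Fx : R -> R -> C) a b u v :
  (forall x, cderiv (fun t => F t x) (fun t => Ft t x)) -> (forall t, cderiv (F t) (Fx t)) ->
  ccont2 F -> ccont2 Ft -> ccont2 Fx ->
  CRInt (fun t => CRInt (F t) u v) a b = CRInt (fun x => CRInt (fun t => F t x) a b) u v.
Proof.
  intros Dt Dx C0 Ct Cx.
  assert (Hx : ccont (fun x => CRInt (fun t => F t x) a b)).
  { apply (cderiv_ccont _ (fun x => CRInt (fun t => Fx t x) a b)).
    apply cderiv_CRInt_param; auto. intros x; apply ccont2_ccont_t, C0. }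
  assert (Ht : forall w, ccont (fun t => CRInt (F t) u w)).
  { intros w. apply (cderiv_ccont _ (fun t => CRInt (Ft t) u w)).
    apply (cderiv_CRInt_param (fun x t => F t x) (fun x t => Ft t x)); auto.
    - intros t. apply ccont2_ccont_x, C0.
    - apply ccont2_swap, Ct. }
  assert (D1 : cderiv (fun w => CRInt (fun t => CRInt (F t) u w) a b) (fun w => CRInt (fun t => F t w) a b)).
  { apply (cderiv_CRInt_param (fun t w => CRInt (F t) u w) F); auto.
    intros t. apply cderiv_CRInt, ccont2_ccont_x, C0. }
  pose proof (cderiv_CRInt _ u Hx) as D2.
  assert (D3 := cderiv_plus _ _ _ _ D1 (cderiv_scal (RtoC (-1)) _ _ D2)).
  eapply cderiv_ext in D3; [|reflexivity|].
  - assert (E := cderiv_zero_const _ D3 v u). cbv beta in E.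
    rewrite (CRInt_ext (fun t => CRInt (F t) u u) (fun _ => RtoC 0)) in E by (intros; apply CRInt_point).
    rewrite CRInt_zero, CRInt_point in E.
    set (A := CRInt (fun t => CRInt (F t) u v) a b) in *.
    set (B := CRInt (fun x => CRInt (fun t => F t x) a b) u v) in *.
    replace A with ((A + RtoC (-1) * B) + B)%C by (apply C_ext; simpl; ring).
    rewrite E. apply C_ext; simpl; ring.
  - intros w. simpl. apply C_ext; simpl; ring.
Qed.

Lemma CRInt_shift h v a b : ccont h -> CRInt (fun y => h (y + v)) a b = CRInt h (a + v) (b + v).
Proof.
  intros H. assert (E := CRInt_comp_lin h 1 v a b H). rewrite !Rmult_1_l, Cmult_1_l in E.
  rewrite <- E. apply CRInt_ext. intros y. rewrite Rmult_1_l. reflexivity.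
Qed.

Lemma CRInt_periodic h a T : ccont h -> (forall t, h (t + T) = h t) -> CRInt h a (a + T) = CRInt h 0 T.
Proof.
  intros H P.
  rewrite <- (CRInt_Chasles h a 0 (a + T) H), <- (CRInt_Chasles h 0 T (a + T) H).
  assert (E : CRInt h T (a + T) = CRInt h 0 a).
  { replace T with (0 + T) at 1 by ring. rewrite <- CRInt_shift by auto. apply CRInt_ext. intros; apply P. }
  rewrite E, (CRInt_swap h 0 a H). ring.
Qed.

Lemma cderiv_cis' (a : R) : cderiv (fun x => cis (a * x)) (fun x => (Ci * RtoC a * cis (a * x)%R)%C).
Proof. eapply cderiv_ext; [| |apply (cderiv_cis a 0)]; intros; simpl; rewrite ?Rplus_0_r; reflexivity. Qed.

Lemma ccont_cis (a : R) : ccont (fun x => cis (a * x)).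
Proof. eapply cderiv_ccont, cderiv_cis'. Qed.

Lemma CRInt_cis (k : Z) a : CRInt (fun t => cis (IZR k * t)) a (a + 2 * PI) =
  if Z.eq_dec k 0 then RtoC (2 * PI) else RtoC 0.
Proof.
  destruct (Z.eq_dec k 0) as [->|nk].
  - rewrite (CRInt_ext _ (fun _ => RtoC 1)).
    + apply C_ext; simpl; rewrite RInt_const; unfold scal; simpl; unfold mult; simpl; ring.
    + intros x. rewrite Rmult_0_l. apply cis_0.
  - assert (hk : IZR k <> 0) by (apply not_0_IZR; exact nk).
    assert (hk' : (Ci * RtoC (IZR k))%C <> RtoC 0).
    { apply Cmult_neq_0.
      - intros E. apply (f_equal Im) in E. simpl in E. lra.
      - intros E. apply (f_equal Re) in E. simpl in E. lra. }
    assert (D := cderiv_scal (/ (Ci * RtoC (IZR k)))%C _ _ (cderiv_cis' (IZR k))).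
    eapply cderiv_ext in D; [|reflexivity|intros x; instantiate (1 := fun x => cis (IZR k * x)); simpl; field; auto].
    + rewrite (CRInt_FTC _ _ a (a + 2 * PI) D (ccont_cis _)).
      replace (IZR k * (a + 2 * PI)) with (IZR k * a + 2 * PI * IZR k) by ring.
      rewrite cis_2PI_Z. ring.
    + split; intros E; apply hk'; rewrite E; ring.
Qed.

(** The difference is written as an integral of [h'], because the mean value theorem in its equality
    form fails for complex values. *)
Lemma cderiv_lip h h' K x y : cderiv h h' -> ccont h' -> (forall z, Cmod (h' z) <= K) ->
  Cmod (h x - h y)%C <= K * Rabs (x - y).
Proof.
  intros D Cc B. assert (W : forall u v, u <= v -> Cmod (h v - h u)%C <= K * (v - u)).
  { intros u v uv. rewrite <- (CRInt_FTC h h' u v D Cc). apply CRInt_bound_const; auto. }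
  destruct (Rle_lt_dec x y) as [p|p].
  - rewrite Cmod_minus_sym, Rabs_minus_sym, (Rabs_pos_eq (y - x)) by lra. apply W; auto.
  - rewrite Rabs_pos_eq by lra. apply W; lra.
Qed.

(** * Synthesis from rapidly decreasing modes *)

Definition rapid (phi : Z -> R -> C) : Prop :=
  forall m g : nat, exists M : R, forall k x,
    Rabs (IZR k) ^ m * Rabs x ^ g * Cmod (phi k x) <= M.
(** [Phi] lists the successive derivatives in [x]; carried as a witness, they can be given by
    formulas. Derivatives in [t] only multiply a mode by powers of [i k], which [rapid] absorbs. *)
Definition smooth_rapid (phi : Z -> R -> C) : Prop :=
  exists Phi : nat -> Z -> R -> C, Phi O = phi /\
    (forall b k, cderiv (Phi b k) (Phi (S b) k)) /\ (forall b, rapid (Phi b)).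
Definition synth (phi : Z -> R -> C) (t x : R) : C :=
  zlim (fun k => (phi k x * cis (IZR k * t))%C).

Lemma rapid_plus phi psi : rapid phi -> rapid psi -> rapid (fun k x => (phi k x + psi k x)%C).
Proof.
  intros H K m g. destruct (H m g) as [M1 h1], (K m g) as [M2 h2]. exists (M1 + M2). intros k x.
  specialize (h1 k x). specialize (h2 k x).
  assert (0 <= Rabs (IZR k) ^ m * Rabs x ^ g) by (apply Rmult_le_pos; apply pow_le, Rabs_pos).
  pose proof (Cmod_triangle (phi k x) (psi k x)). nra.
Qed.

(** Factors of polynomial growth are absorbed: expanding [(1 + |k|^p) (1 + |x|^q)] leaves four
    weighted norms of [phi], bounded by [M1] to [M4]. *)
Lemma rapid_dominated phi psi A p q : 0 <= A ->
  (forall k x, Cmod (psi k x) <= A * (1 + Rabs (IZR k) ^ p) * (1 + Rabs x ^ q) * Cmod (phi k x)) ->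
  rapid phi -> rapid psi.
Proof.
  intros hA D H m g.
  destruct (H m g) as [M1 h1], (H (m + p)%nat g) as [M2 h2], (H m (g + q)%nat) as [M3 h3],
    (H (m + p)%nat (g + q)%nat) as [M4 h4].
  exists (A * (M1 + M2 + M3 + M4)). intros k x.
  specialize (h1 k x); specialize (h2 k x); specialize (h3 k x); specialize (h4 k x).
  rewrite !pow_add in *. specialize (D k x).
  set (u := Rabs (IZR k) ^ m) in *. set (v := Rabs x ^ g) in *.
  assert (0 <= u * v) by (apply Rmult_le_pos; apply pow_le, Rabs_pos).
  eapply Rle_trans; [apply Rmult_le_compat_l; [auto|exact D]|].
  set (U := Rabs (IZR k) ^ p) in *. set (V := Rabs x ^ q) in *. set (c := Cmod (phi k x)) in *.
  replace (u * v * (A * (1 + U) * (1 + V) * c)) with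
    (A * (u * v * c + u * U * v * c + u * (v * V) * c + u * U * (v * V) * c)) by ring.
  apply Rmult_le_compat_l; lra.
Qed.

Lemma rapid_scal c phi : rapid phi -> rapid (fun k x => (c * phi k x)%C).
Proof.
  intros H. apply (rapid_dominated phi _ (Cmod c) 0 0); auto using Cmod_ge_0.
  intros k x. rewrite Cmod_mult. simpl.
  assert (0 <= Cmod c * Cmod (phi k x)) by (apply Rmult_le_pos; apply Cmod_ge_0). lra.
Qed.

Lemma rapid_mult_k phi : rapid phi -> rapid (fun k x => (Ci * RtoC (IZR k) * phi k x)%C).
Proof.
  intros H. apply (rapid_dominated phi _ 1 1 0); [lra| |auto].
  intros k x. rewrite !Cmod_mult, Cmod_Ci, Cmod_R. simpl.
  pose proof (Rabs_pos (IZR k)). pose proof (Cmod_ge_0 (phi k x)). nra.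
Qed.

(** The weights [1 + k^2] and [1 + x^2] are positive, so one can divide by them, unlike [|k|] and
    [|x|]. Each induction step inserts one quadratic factor by [rapid_dominated]. The converse
    passage is [rapid_of_bound]. *)
Lemma rapid_bound phi : rapid phi -> forall m g : nat, exists M, 0 <= M /\ forall k x,
  (1 + IZR k * IZR k) ^ m * (1 + x * x) ^ g * Cmod (phi k x) <= M.
Proof.
  intros H m g.
  assert (E : rapid (fun k x => (RtoC ((1 + IZR k * IZR k) ^ m * (1 + x * x) ^ g) * phi k x)%C)).
  { assert (Q : forall y, Rabs y * (Rabs y * 1) = y * y)
      by (intros y; rewrite Rmult_1_r, <- Rabs_mult; apply Rabs_pos_eq; nra).
    induction m as [|m IH]; [induction g as [|g IH]|].
    - eapply rapid_dominated with (A := 1) (p := 0%nat) (q := 0%nat); [lra| |exact H].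
      intros k x. simpl. rewrite Cmod_mult, Cmod_R, Rmult_1_r, Rabs_R1.
      pose proof (Cmod_ge_0 (phi k x)). lra.
    - eapply rapid_dominated with (A := 1) (p := 0%nat) (q := 2%nat); [lra| |exact IH].
      intros k x. rewrite !Cmod_mult, !Cmod_R. simpl pow. rewrite Q.
      rewrite !Rabs_mult, (Rabs_pos_eq (1 + x * x)) by nra.
      set (Y := Rabs ((1 + x * x) ^ g)). set (Z := Cmod (phi k x)).
      assert (0 <= Y * Z) by (apply Rmult_le_pos; [apply Rabs_pos|apply Cmod_ge_0]).
      assert (0 <= Y * Z * (1 + x * x)) by (apply Rmult_le_pos; [auto|nra]).
      rewrite Rabs_R1. lra.
    - eapply rapid_dominated with (A := 1) (p := 2%nat) (q := 0%nat); [lra| |exact IH].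
      intros k x. rewrite !Cmod_mult, !Cmod_R. simpl pow. rewrite Q.
      rewrite !Rabs_mult, (Rabs_pos_eq (1 + IZR k * IZR k)) by nra.
      set (Y := Rabs ((1 + x * x) ^ g)). set (X := Rabs ((1 + IZR k * IZR k) ^ m)).
      set (Z := Cmod (phi k x)).
      assert (0 <= X * Y * Z)
        by (apply Rmult_le_pos; [apply Rmult_le_pos; apply Rabs_pos|apply Cmod_ge_0]).
      assert (0 <= X * Y * Z * (1 + IZR k * IZR k)) by (apply Rmult_le_pos; [auto|nra]).
      lra. }
  destruct (E 0%nat 0%nat) as [M hM]. exists M.
  assert (W : forall k x, (1 + IZR k * IZR k) ^ m * (1 + x * x) ^ g * Cmod (phi k x) <= M).
  { intros k x. specialize (hM k x). simpl in hM. rewrite Cmod_mult, Cmod_R, Rabs_pos_eq in hM; [lra|].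
    apply Rmult_le_pos; apply pow_le; nra. }
  split; auto. specialize (W 0%Z 0). eapply Rle_trans; [|exact W].
  apply Rmult_le_pos; [apply Rmult_le_pos; apply pow_le; nra|apply Cmod_ge_0].
Qed.

Lemma rapid_weighted_bound phi g : rapid phi -> exists M, 0 <= M /\ forall k x,
  (1 + x * x) ^ g * Cmod (phi k x) <= M / (1 + IZR k * IZR k).
Proof.
  intros H. destruct (rapid_bound phi H 1 g) as [M [M0 hM]]. exists M. split; auto.
  intros k x. apply div_le_r; [apply one_sqr_pos|]. specialize (hM k x). simpl in hM. nra.
Qed.

Lemma rapid_summable phi : rapid phi -> exists M, forall t x,
  summable M (fun k => (phi k x * cis (IZR k * t))%C).
Proof.
  intros H. destruct (rapid_weighted_bound phi 0 H) as [M [_ hM]]. exists M. intros t x k.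
  specialize (hM k x). rewrite Cmod_mult, Cmod_cis. simpl in hM. lra.
Qed.

Lemma synth_plus phi psi t x : rapid phi -> rapid psi ->
  synth (fun k x => (phi k x + psi k x)%C) t x = (synth phi t x + synth psi t x)%C.
Proof.
  intros H K. destruct (rapid_summable _ H) as [A hA], (rapid_summable _ K) as [B hB].
  unfold synth. rewrite <- (zlim_plus A B); auto. apply zlim_ext. intros k; ring.
Qed.

Lemma synth_scal c phi t x : rapid phi ->
  synth (fun k x => (c * phi k x)%C) t x = (c * synth phi t x)%C.
Proof.
  intros H. destruct (rapid_summable _ H) as [A hA].
  unfold synth. rewrite <- (zlim_scal A); auto. apply zlim_ext. intros k; ring.
Qed.

Lemma smooth_rapid_is_rapid phi : smooth_rapid phi -> rapid phi.
Proof. intros [Phi [<- [_ H]]]. apply H. Qed.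

Lemma smooth_rapid_derive phi : smooth_rapid phi -> exists phi', smooth_rapid phi' /\ forall k, cderiv (phi k) (phi' k).
Proof.
  intros [Phi [<- [D H]]]. exists (Phi 1%nat). split; auto.
  exists (fun b => Phi (S b)). auto.
Qed.

Lemma smooth_rapid_mult_k phi : smooth_rapid phi -> smooth_rapid (fun k x => (Ci * RtoC (IZR k) * phi k x)%C).
Proof.
  intros [Phi [<- [D H]]]. exists (fun b k x => (Ci * RtoC (IZR k) * Phi b k x)%C). split; auto. split.
  - intros b k. apply cderiv_scal, D.
  - intros b. apply rapid_mult_k, H.
Qed.

Lemma smooth_rapid_ccont phi k : smooth_rapid phi -> ccont (phi k).
Proof. intros H. destruct (smooth_rapid_derive phi H) as [phi' [_ D]]. eapply cderiv_ccont, D. Qed.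

Lemma ccont_scal c h : ccont h -> ccont (fun x => (c * h x)%C).
Proof. intros; apply ccont_mult; [apply ccont_const|auto]. Qed.

Lemma synth_cderiv_t phi x : rapid phi ->
  cderiv (fun t => synth phi t x) (fun t => synth (fun k x => (Ci * RtoC (IZR k) * phi k x)%C) t x).
Proof.
  intros H. destruct (rapid_summable _ H) as [A hA], (rapid_summable _ (rapid_mult_k _ H)) as [B hB].
  unfold synth. apply zlim_cderiv.
  - intros r _. exists A. intros; apply hA.
  - intros r _. exists B. intros; apply hB.
  - intros k. eapply cderiv_ext; [reflexivity| |apply (cderiv_scal (phi k x) _ _ (cderiv_cis' (IZR k)))].
    intros t; simpl. ring.
  - intros k. apply ccont_scal, ccont_cis.
Qed.

Lemma synth_cderiv_x phi phi' t : smooth_rapid phi -> smooth_rapid phi' -> (forall k, cderiv (phi k) (phi' k)) ->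
  cderiv (fun x => synth phi t x) (fun x => synth phi' t x).
Proof.
  intros H H' D. destruct (rapid_summable _ (smooth_rapid_is_rapid _ H)) as [A hA], (rapid_summable _ (smooth_rapid_is_rapid _ H')) as [B hB].
  unfold synth. apply zlim_cderiv.
  - intros r _. exists A. intros; apply hA.
  - intros r _. exists B. intros; apply hB.
  - intros k. eapply cderiv_ext; [| |apply (cderiv_scal (cis (IZR k * t)) _ _ (D k))]; intros; simpl; ring.
  - intros k. apply ccont_mult; [apply smooth_rapid_ccont; auto|apply ccont_const].
Qed.

Lemma cderiv_dt f f' : (forall x, cderiv (fun t => f t x) (fun t => f' t x)) -> dt f = f' /\ has_dt f.
Proof.
  intros H. split.
  - apply functional_extensionality; intros t. apply functional_extensionality; intros x.
    destruct (H x t) as [a b]. apply C_ext; simpl; apply is_derive_unique; auto.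
  - intros t x. destruct (H x t) as [a b]. split; eexists; eauto.
Qed.

Lemma cderiv_dx f f' : (forall t, cderiv (f t) (f' t)) -> dx f = f' /\ has_dx f.
Proof.
  intros H. split.
  - apply functional_extensionality; intros t. apply functional_extensionality; intros x.
    destruct (H t x) as [a b]. apply C_ext; simpl; apply is_derive_unique; auto.
  - intros t x. destruct (H t x) as [a b]. split; eexists; eauto.
Qed.

Lemma synth_bound phi : rapid phi -> exists K, forall t x, Cmod (synth phi t x) <= K.
Proof.
  intros H. destruct (rapid_summable _ H) as [M hM]. exists (8 * M). intros t x.
  apply zlim_norm, hM.
Qed.

Lemma synth_dt phi : smooth_rapid phi -> dt (synth phi) = synth (fun k x => (Ci * RtoC (IZR k) * phi k x)%C).
Proof.
  intros H. apply (cderiv_dt (synth phi)). intros x. apply synth_cderiv_t, smooth_rapid_is_rapid, H.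
Qed.

(** Joint continuity comes from Lipschitz bounds in [t] and in [x], uniform in the other variable:
    the series of both derivatives are bounded on the whole plane. *)
Lemma synth_cont2 phi : smooth_rapid phi -> cont2 (synth phi).
Proof.
  intros H. destruct (smooth_rapid_derive phi H) as [phi' [H' D]].
  destruct (synth_bound phi' (smooth_rapid_is_rapid _ H')) as [K1 h1].
  destruct (synth_bound _ (rapid_mult_k _ (smooth_rapid_is_rapid _ H))) as [K2 h2].
  assert (p1 : 0 <= K1) by (eapply Rle_trans; [apply Cmod_ge_0|apply (h1 0 0)]).
  assert (p2 : 0 <= K2) by (eapply Rle_trans; [apply Cmod_ge_0|apply (h2 0 0)]).
  destruct (smooth_rapid_derive phi' H') as [phi'' [H'' D']].
  intros t0 x0. apply filterlim_locally. intros eps.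
  assert (dp : 0 < eps / (K1 + K2 + 1)) by (apply Rdiv_lt_0_compat; [apply cond_pos|lra]).
  exists (mkposreal _ dp). intros [t x] [bt bx]. simpl in bt, bx |- *.
  unfold ball in bt, bx; simpl in bt, bx. unfold AbsRing_ball, abs, minus, plus, opp in bt, bx; simpl in bt, bx.
  change (Rabs (t - t0) < eps / (K1 + K2 + 1)) in bt. change (Rabs (x - x0) < eps / (K1 + K2 + 1)) in bx.
  assert (L : Cmod (synth phi t x - synth phi t0 x0)%C < eps).
  { replace (synth phi t x - synth phi t0 x0)%C with
      ((synth phi t x - synth phi t0 x) + (synth phi t0 x - synth phi t0 x0))%C by ring.
    eapply Rle_lt_trans; [apply Cmod_triangle|].
    assert (A1 : Cmod (synth phi t x - synth phi t0 x)%C <= K2 * Rabs (t - t0)).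
    { apply (cderiv_lip (fun t => synth phi t x) _ K2 t t0 (synth_cderiv_t phi x (smooth_rapid_is_rapid _ H))); auto.
      apply (cderiv_ccont _ _ (synth_cderiv_t _ x (rapid_mult_k _ (smooth_rapid_is_rapid _ H)))). }
    assert (A2 : Cmod (synth phi t0 x - synth phi t0 x0)%C <= K1 * Rabs (x - x0)).
    { apply (cderiv_lip (fun x => synth phi t0 x) _ K1 x x0 (synth_cderiv_x phi phi' t0 H H' D)); auto.
      apply (cderiv_ccont _ _ (synth_cderiv_x phi' phi'' t0 H' H'' D')). }
    set (d := eps / (K1 + K2 + 1)) in *.
    assert (E : d * (K1 + K2 + 1) = eps) by (unfold d; field; lra).
    assert (K2 * Rabs (t - t0) <= K2 * d) by (apply Rmult_le_compat_l; lra).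
    assert (K1 * Rabs (x - x0) <= K1 * d) by (apply Rmult_le_compat_l; lra). lra. }
  split.
  - change (Rabs (Re (synth phi t x - synth phi t0 x0)%C) < eps).
    eapply Rle_lt_trans; [apply re_le_Cmod|exact L].
  - change (Rabs (Im (synth phi t x - synth phi t0 x0)%C) < eps).
    eapply Rle_lt_trans; [apply Im_le_Cmod|exact L].
Qed.

(** Closure of the class of synthesized functions under both derivatives: induction on words then
    reduces every claim about derivatives to a claim about the class. *)
Lemma synth_step phi : smooth_rapid phi ->
  (exists psi, smooth_rapid psi /\ dt (synth phi) = synth psi) /\
  (exists psi, smooth_rapid psi /\ dx (synth phi) = synth psi) /\
  has_dt (synth phi) /\ has_dx (synth phi).
Proof.
  intros H. destruct (smooth_rapid_derive phi H) as [phi' [H' D]].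
  destruct (cderiv_dt (synth phi) (synth (fun k x => (Ci * RtoC (IZR k) * phi k x)%C))) as [e1 d1].
  { intros x. apply synth_cderiv_t, smooth_rapid_is_rapid, H. }
  destruct (cderiv_dx (synth phi) (synth phi')) as [e2 d2].
  { intros t. apply synth_cderiv_x; auto. }
  split; [eexists; split; [apply smooth_rapid_mult_k, H|exact e1]|].
  split; [exists phi'; auto|]. auto.
Qed.

Lemma synth_schwartz phi : smooth_rapid phi -> schwartz (synth phi).
Proof.
  intros H. split; [|split].
  - intros t x. apply zlim_ext. intros k.
    replace (IZR k * (t + 2 * PI)) with (IZR k * t + 2 * PI * IZR k) by ring.
    rewrite cis_2PI_Z. reflexivity.
  - intros w.
    assert (E : exists psi, smooth_rapid psi /\ dword w (synth phi) = synth psi).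
    { induction w as [|b w [psi [Hp IH]]]; simpl; [exists phi; auto|].
      rewrite IH. destruct (synth_step psi Hp) as [h1 [h2 _]]. destruct b; auto. }
    destruct E as [psi [Hp E]]. rewrite E.
    destruct (synth_step psi Hp) as [_ [_ [h1 h2]]]. split; [|split]; auto.
    apply synth_cont2, Hp.
  - intros a b g.
    assert (E : exists psi, smooth_rapid psi /\ dtx a b (synth phi) = synth psi).
    { unfold dtx. induction a as [|a [psi [Hp IH]]]; simpl.
      - induction b as [|b [psi [Hp IH]]]; simpl; [exists phi; auto|].
        rewrite IH. apply (synth_step psi Hp).
      - rewrite IH. apply (synth_step psi Hp). }
    destruct E as [psi [Hp E]]. rewrite E.
    destruct (rapid_weighted_bound psi g (smooth_rapid_is_rapid _ Hp)) as [M [_ hM]].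
    destruct (rapid_summable psi (smooth_rapid_is_rapid _ Hp)) as [A hA].
    (* The power [x ^ g] is moved into the series, where [|x| ^ g <= (1 + x * x) ^ g] and the decay
       of the modes controls it. *)
    exists (8 * M). intros t x. unfold synth. rewrite <- (zlim_scal A) by apply hA.
    apply zlim_norm. intros k. eapply Rle_trans; [|apply (hM k x)].
    rewrite !Cmod_mult, Cmod_cis, Cmod_R, Rmult_1_r.
    apply Rmult_le_compat_r; [apply Cmod_ge_0|].
    rewrite <- RPow_abs. apply pow_incr. split; [apply Rabs_pos|].
    unfold Rabs; destruct Rcase_abs; nra.
Qed.

(** * Fourier coefficients of Schwartz functions *)

Definition coef (g : R -> R -> C) (k : Z) (x : R) : C :=
  (RtoC (/ (2 * PI)) * CRInt (fun t => (g t x * cis (- IZR k * t)%R)%C) 0 (2 * PI))%C.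

Lemma has_dt_cderiv g : has_dt g -> forall x, cderiv (fun t => g t x) (fun t => dt g t x).
Proof. intros H x t. destruct (H t x). split; apply Derive_correct; auto. Qed.

Lemma has_dx_cderiv g : has_dx g -> forall t, cderiv (g t) (dx g t).
Proof. intros H t x. destruct (H t x). split; apply Derive_correct; auto. Qed.

Lemma dtx_dword a b f : dtx a b f = dword (repeat true a ++ repeat false b) f.
Proof.
  unfold dtx. induction a as [|a IH]; simpl.
  - induction b as [|b IH]; simpl; [reflexivity|]. rewrite IH; reflexivity.
  - rewrite IH; reflexivity.
Qed.

Section Coefficients.
Variable f : R -> R -> C.
Hypothesis Hf : schwartz f.

Lemma dtx_regular a b : has_dt (dtx a b f) /\ has_dx (dtx a b f) /\ ccont2 (dtx a b f).
Proof.
  destruct Hf as [_ [S _]]. rewrite dtx_dword.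
  destruct (S (repeat true a ++ repeat false b)) as [h1 [h2 h3]]. auto using cont2_ccont2.
Qed.

(** Makes the boundary terms cancel in [coef_dt]. *)
Lemma dtx_periodic a b : periodic_t (dtx a b f).
Proof.
  assert (P : forall g, periodic_t g -> periodic_t (dx g)).
  { intros g H t x. unfold dx. f_equal; apply Derive_ext; intros; rewrite H; reflexivity. }
  assert (Q : forall g, has_dt g -> periodic_t g -> periodic_t (dt g)).
  { intros g Hg H t x. pose proof (cderiv_comp_lin _ _ 1 (2 * PI) (has_dt_cderiv g Hg x)) as D.
    eapply cderiv_ext in D; [| |intros s; reflexivity].
    2:{ intros s. instantiate (1 := fun s => g s x). simpl. rewrite Rmult_1_l. apply H. }
    destruct (D t) as [d1 d2]. rewrite Cmult_1_l, Rmult_1_l in d1, d2.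
    symmetry. apply C_ext; simpl.
    - apply is_derive_unique. exact d1.
    - apply is_derive_unique. exact d2. }
  induction a as [|a IH].
  - induction b as [|b IH]; [apply Hf|]. apply P, IH.
  - apply Q; [apply dtx_regular|exact IH].
Qed.

Lemma coef_norm g k x K : ccont (fun t => g t x) ->
  (forall t, Cmod (g t x) <= K) -> Cmod (coef g k x) <= K.
Proof.
  intros Hc B. unfold coef. rewrite Cmod_mult, Cmod_R.
  pose proof PI_RGT_0 as p. assert (0 < / (2 * PI)) by (apply Rinv_0_lt_compat; lra).
  rewrite Rabs_pos_eq by lra.
  assert (E : Cmod (CRInt (fun t => (g t x * cis (- IZR k * t)%R)%C) 0 (2 * PI)) <= K * (2 * PI - 0)).
  { apply CRInt_bound_const; [lra| |].
    - apply ccont_mult; [exact Hc|apply ccont_cis].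
    - intros t _. rewrite Cmod_mult, Cmod_cis, Rmult_1_r. apply B. }
  apply Rmult_le_compat_l with (r := / (2 * PI)) in E; [|lra].
  eapply Rle_trans; [exact E|]. right. field. lra.
Qed.

Lemma coef_cderiv b k : cderiv (coef (dtx 0 b f) k) (coef (dtx 0 (S b) f) k).
Proof.
  destruct (dtx_regular 0 b) as [h1 [h2 h3]].
  unfold coef. apply cderiv_scal.
  apply (cderiv_CRInt_param (fun t x => (dtx 0 b f t x * cis (- IZR k * t)%R)%C)
    (fun t x => (dtx 0 (S b) f t x * cis (- IZR k * t)%R)%C)).
  - intros t. eapply cderiv_ext; [| |apply (cderiv_scal (cis (- IZR k * t)) _ _ (has_dx_cderiv _ h2 t))];
    intros; simpl; ring.
  - intros x. apply ccont_mult; [apply ccont2_ccont_t, h3|apply ccont_cis].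
  - apply ccont2_mult; [apply (dtx_regular 0 (S b))|apply ccont2_t, ccont_cis].
Qed.

(** Integration by parts over a period; the boundary terms cancel since both factors are
    [2 * PI]-periodic. *)
Lemma coef_dt a b k x : coef (dtx (S a) b f) k x = (Ci * RtoC (IZR k) * coef (dtx a b f) k x)%C.
Proof.
  destruct (dtx_regular a b) as [h1 [h2 h3]].
  set (g := dtx a b f) in *.
  assert (D := cderiv_mult _ _ _ _ (has_dt_cderiv g h1 x) (cderiv_cis' (- IZR k))).
  assert (c1 : ccont (fun t => dt g t x)) by apply ccont2_ccont_t, (dtx_regular (S a) b).
  assert (ccont2' : ccont (fun t => g t x)) by apply ccont2_ccont_t, h3.
  assert (cc := ccont_cis (- IZR k)).
  assert (F := CRInt_FTC _ _ 0 (2 * PI) D).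
  rewrite CRInt_plus in F; [|apply ccont_mult; auto|apply ccont_mult; [auto|apply ccont_scal; auto]].
  assert (F' := F (ccont_plus _ _ (ccont_mult _ _ c1 cc) (ccont_mult _ _ ccont2' (ccont_scal _ _ cc)))). clear F.
  rewrite (CRInt_ext (fun x0 => (g x0 x * (Ci * (- IZR k)%R * cis (- IZR k * x0)%R))%C)
     (fun t => ((- (Ci * RtoC (IZR k))) * (g t x * cis (- IZR k * t)%R))%C)) in F'
    by (intros t; rewrite RtoC_opp; ring).
  rewrite CRInt_scal in F' by (apply ccont_mult; auto).
  assert (E0 : cis (- IZR k * (2 * PI)) = cis (- IZR k * 0)).
  { rewrite <- (cis_2PI_Z (- IZR k * 0) (- k)). f_equal. rewrite opp_IZR. ring. }
  rewrite E0 in F'.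
  assert (P : g (2 * PI) x = g 0 x).
  { pose proof (dtx_periodic a b 0 x) as P. fold g in P. rewrite Rplus_0_l in P. exact P. }
  rewrite P in F'.
  unfold coef. change (dtx (S a) b f) with (dt g).
  set (A := CRInt (fun t => (dt g t x * cis (- IZR k * t)%R)%C) 0 (2 * PI)) in *.
  set (B := CRInt (fun t => (g t x * cis (- IZR k * t)%R)%C) 0 (2 * PI)) in *.
  replace A with ((A + - (Ci * RtoC (IZR k)) * B) + Ci * RtoC (IZR k) * B)%C by ring.
  rewrite F'. ring.
Qed.

(** Each factor [|k|] is traded for one derivative in [t] by [coef_dt], and [x ^ g] passes under the
    integral in [t]; what remains is a Schwartz seminorm of [f]. *)
Lemma coef_rapid b : rapid (coef (dtx 0 b f)).
Proof.
  intros m g. destruct (proj2 (proj2 Hf) m b g) as [M hM]. exists M. intros k x.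
  assert (E : forall n, Cmod (coef (dtx n b f) k x) = Rabs (IZR k) ^ n * Cmod (coef (dtx 0 b f) k x)).
  { induction n as [|n IH]; [simpl; ring|].
    rewrite coef_dt, !Cmod_mult, Cmod_Ci, Cmod_R, IH. simpl. ring. }
  replace (Rabs (IZR k) ^ m * Rabs x ^ g * Cmod (coef (dtx 0 b f) k x)) with
    (Rabs x ^ g * Cmod (coef (dtx m b f) k x)) by (rewrite E; ring).
  assert (xg : 0 <= Rabs x ^ g) by apply pow_le, Rabs_pos.
  assert (G : Cmod (coef (fun t x => (RtoC (x ^ g) * dtx m b f t x)%C) k x) <= M).
  { apply coef_norm; [|intros t; apply hM]. apply ccont_scal, ccont2_ccont_t, dtx_regular. }
  replace (coef (fun t x => (RtoC (x ^ g) * dtx m b f t x)%C) k x) with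
    (RtoC (x ^ g) * coef (dtx m b f) k x)%C in G.
  - rewrite Cmod_mult, Cmod_R, <- RPow_abs in G. exact G.
  - unfold coef.
    rewrite (CRInt_ext (fun t => (RtoC (x ^ g) * dtx m b f t x * cis (- IZR k * t)%R)%C)
      (fun t => (RtoC (x ^ g) * (dtx m b f t x * cis (- IZR k * t)%R))%C)) by (intros; ring).
    rewrite CRInt_scal; [ring|]. apply ccont_mult; [apply ccont2_ccont_t, dtx_regular|apply ccont_cis].
Qed.

(** The test expresses [- N <= m < N], the asymmetric range of [zsum]. *)
Lemma zsum_delta (a : Z -> C) (m : Z) : (forall k, k <> m -> a k = RtoC 0) ->
  forall N, zsum a N = if Z_lt_dec (Z.max m (- m - 1)) (Z.of_nat N) then a m else RtoC 0.
Proof.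
  intros H N. induction N as [|N IH]; simpl zsum.
  - destruct Z_lt_dec; [|reflexivity]. simpl in *. lia.
  - rewrite IH.
    destruct (Z.eq_dec (Z.of_nat N) m) as [e1|e1].
    + destruct Z_lt_dec; [lia|]. destruct Z_lt_dec; [|lia]. rewrite e1, (H (- m - 1)%Z) by lia. ring.
    + rewrite (H (Z.of_nat N)) by auto.
      destruct (Z.eq_dec (- Z.of_nat N - 1) m) as [e2|e2].
      * destruct Z_lt_dec; [lia|]. destruct Z_lt_dec; [|lia]. rewrite e2. ring.
      * rewrite (H (- Z.of_nat N - 1)%Z) by auto.
        destruct Z_lt_dec, Z_lt_dec; try lia; ring.
Qed.

Lemma zlim_delta (a : Z -> C) (m : Z) : (forall k, k <> m -> a k = RtoC 0) -> zlim a = a m.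
Proof.
  intros H. apply (zlim_unique (Cmod (a m) * (1 + IZR m * IZR m))).
  - intros k. destruct (Z.eq_dec k m) as [->|n].
    + right. field. pose proof (one_sqr_pos (IZR m)). lra.
    + rewrite H, Cmod_0 by auto. apply Rmult_le_pos.
      * apply Rmult_le_pos; [apply Cmod_ge_0|left; apply one_sqr_pos].
      * left. apply Rinv_0_lt_compat, one_sqr_pos.
  - intros eps he. exists (Z.to_nat (Z.abs m) + 2)%nat. intros N hN.
    rewrite (zsum_delta a m H). destruct Z_lt_dec; [|lia].
    replace (a m - a m)%C with (RtoC 0) by ring. rewrite Cmod_0. lra.
Qed.

(** At fixed [x] the difference of the two sides is continuous in [t] and orthogonal to every
    exponential, so [trig_coefs_zero] applies at the point [t] itself. *)
Lemma fourier_inversion t x : f t x = synth (coef f) t x.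
Proof.
  pose proof PI_RGT_0 as pi0.
  assert (Rf : rapid (coef f)) by apply (coef_rapid 0).
  destruct (rapid_summable _ Rf) as [M hM].
  assert (cf : ccont (fun t => f t x)) by apply ccont2_ccont_t, (dtx_regular 0 0).
  assert (cs : ccont (fun t => synth (coef f) t x)) by apply (cderiv_ccont _ _ (synth_cderiv_t _ x Rf)).
  enough (E : (f t x - synth (coef f) t x)%C = RtoC 0).
  { replace (f t x) with ((f t x - synth (coef f) t x) + synth (coef f) t x)%C by ring. rewrite E. ring. }
  apply (trig_coefs_zero (fun t => (f t x - synth (coef f) t x)%C)).
  { apply ccont_minus; auto. }
  intros j.
  rewrite (CRInt_ext _ (fun t => (f t x * cis (IZR j * t) - synth (coef f) t x * cis (IZR j * t))%C))
    by (intros; ring).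
  rewrite CRInt_minus; [|apply ccont_mult; [auto|apply ccont_cis]|apply ccont_mult; [auto|apply ccont_cis]].
  replace (t + PI) with (t - PI + 2 * PI) by ring.
  assert (pj : forall s, cis (IZR j * (s + 2 * PI)) = cis (IZR j * s)).
  { intros s. replace (IZR j * (s + 2 * PI)) with (IZR j * s + 2 * PI * IZR j) by ring. apply cis_2PI_Z. }
  (* [trig_coefs_zero] works on a period centred at [t], [coef] on [[0, 2 * PI]]; periodicity
     reconciles them. *)
  rewrite (CRInt_periodic (fun t => (f t x * cis (IZR j * t))%C)).
  2:{ apply ccont_mult; [auto|apply ccont_cis]. }
  2:{ intros s. rewrite (proj1 Hf), pj. reflexivity. }
  assert (E1 : CRInt (fun t => (f t x * cis (IZR j * t))%C) 0 (2 * PI) = (RtoC (2 * PI) * coef f (- j) x)%C).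
  { unfold coef. rewrite Cmult_assoc, <- RtoC_mult, Rinv_r, Cmult_1_l by lra.
    apply CRInt_ext. intros s. rewrite opp_IZR, Ropp_involutive. reflexivity. }
  rewrite E1.
  assert (E2 : CRInt (fun t => (synth (coef f) t x * cis (IZR j * t))%C) (t - PI) (t - PI + 2 * PI) =
     zlim (fun k => CRInt (fun t => (coef f k x * cis (IZR (k + j) * t))%C) (t - PI) (t - PI + 2 * PI))).
  { rewrite <- (zlim_CRInt (fun k t => (coef f k x * cis (IZR (k + j) * t))%C)).
    - apply CRInt_ext. intros s. unfold synth. rewrite Cmult_comm, <- (zlim_scal M) by apply hM.
      apply zlim_ext. intros k. rewrite plus_IZR, Rmult_plus_distr_r, cis_plus. ring.
    - lra.
    - intros A _. exists M. intros s _ k. specialize (hM s x k).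
      cbv beta in hM. rewrite Cmod_mult, Cmod_cis in hM. rewrite Cmod_mult, Cmod_cis. exact hM.
    - intros k. apply ccont_scal, ccont_cis. }
  (* Termwise integration leaves only the mode [k = - j], which matches the coefficient found in
     [E1]. *)
  rewrite E2, (zlim_delta _ (- j)%Z).
  - rewrite CRInt_scal, CRInt_cis by apply ccont_cis. destruct Z.eq_dec; [|lia]. ring.
  - intros k hk. rewrite CRInt_scal, CRInt_cis by apply ccont_cis. destruct Z.eq_dec; [lia|]. ring.
Qed.
End Coefficients.

(** * The mixed Fourier transform *)

(** The integral of [1 / (1 + x^2)] from [X] to [+oo], used as the common measure of truncation
    errors. *)
Definition atail (X : R) : R := PI / 2 - atan X.

Lemma atail_pos X : 0 < atail X.
Proof. unfold atail. pose proof (atan_bound X). lra. Qed.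

Lemma atail_decr X Y : X <= Y -> atail Y <= atail X.
Proof.
  intros [h| ->]; [|lra]. unfold atail. pose proof (atan_increasing X Y h). lra.
Qed.

Lemma atail_small eps : 0 < eps -> exists A, 0 < A /\ forall X, A <= X -> atail X <= eps.
Proof.
  (* The cap at 1 keeps [PI / 2 - e] positive, inside the range where [atan] inverts [tan]. *)
  intros he. set (e := Rmin eps 1).
  assert (e0 : 0 < e) by (unfold e; apply Rmin_glb_lt; lra).
  assert (e1 : e <= 1) by (unfold e; apply Rmin_r).
  assert (e2 : e <= eps) by (unfold e; apply Rmin_l).
  pose proof PI2_3_2.
  exists (Rmax 1 (tan (PI / 2 - e))). split; [pose proof (Rmax_l 1 (tan (PI / 2 - e))); lra|].
  intros X hX. assert (h : tan (PI / 2 - e) <= X) by (eapply Rle_trans; [apply Rmax_r|exact hX]).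
  apply Rle_trans with (2 := e2). eapply Rle_trans; [apply (atail_decr _ _ h)|].
  unfold atail. rewrite atan_tan; lra.
Qed.

Lemma atail_lim c : is_lim_seq (fun n => c * atail (INR n)) 0.
Proof.
  replace (Finite 0) with (Rbar_mult c 0) by (simpl; f_equal; ring).
  apply is_lim_seq_scal_l, is_lim_seq_spec. intros eps.
  destruct (atail_small (eps / 2)) as [A [A0 hA]]; [pose proof (cond_pos eps); lra|].
  exists (Z.to_nat (up A)). intros n hn. rewrite Rminus_0_r, Rabs_pos_eq by (left; apply atail_pos).
  eapply Rle_lt_trans; [apply hA|pose proof (cond_pos eps); lra].
  destruct (archimed A) as [a1 _]. apply Rle_trans with (IZR (up A)); [lra|].
  rewrite INR_IZR_INZ. apply IZR_le. lia.
Qed.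

Lemma improper_left h B : ccont h -> (forall x, x <= 0 -> Cmod (h x) <= B / (1 + x * x)) ->
  exists l, forall X, 0 <= X -> Cmod (l - CRInt h (- X) 0)%C <= B * atail X.
Proof.
  intros H Hb.
  assert (B0 : 0 <= B).
  { specialize (Hb 0 (Rle_refl 0)). pose proof (Cmod_ge_0 (h 0)).
    replace (B / (1 + 0 * 0)) with B in Hb by field. lra. }
  assert (W : forall X X', 0 <= X <= X' -> Cmod (CRInt h (- X') 0 - CRInt h (- X) 0)%C <= B * atail X).
  { intros X X' hX. rewrite <- (CRInt_Chasles h (- X') (- X) 0 H).
    replace (CRInt h (- X') (- X) + CRInt h (- X) 0 - CRInt h (- X) 0)%C with (CRInt h (- X') (- X)) by ring.
    eapply Rle_trans; [apply (CRInt_atan_bound h B (- X') (- X)); [lra|exact H|]|].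
    - intros x hx. apply Hb. lra.
    - rewrite !atan_opp. unfold atail. pose proof (atan_bound X').
      apply Rmult_le_compat_l; lra. }
  (* The limit is taken along the integers; the estimate is then carried to real [X] by the Cauchy
     bound [W]. *)
  set (a := fun n => CRInt h (- INR n) 0).
  assert (L : forall n, Cmod (clim a - a n)%C <= B * atail (INR n)).
  { apply (clim_bound a (fun n => B * atail (INR n)) (atail_lim _)).
    intros n m hnm. apply W. split; [apply pos_INR|apply le_INR, hnm]. }
  exists (clim a). intros X hX. apply Cmod_le_eps. intros eps he.
  assert (E := atail_lim B). apply is_lim_seq_spec in E.
  destruct (E (mkposreal eps he)) as [N hN]. simpl in hN.
  set (n := (N + Z.to_nat (up X))%nat).
  assert (U : X <= INR n).
  { destruct (archimed X) as [z1 _]. apply Rle_trans with (IZR (up X)); [lra|].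
    rewrite INR_IZR_INZ. apply IZR_le. unfold n. lia. }
  exists (a n - CRInt h (- X) 0)%C. split; [|apply W; lra].
  replace (clim a - CRInt h (- X) 0 - (a n - CRInt h (- X) 0))%C with (clim a - a n)%C by ring.
  eapply Rle_trans; [apply L|]. specialize (hN n ltac:(unfold n; lia)).
  rewrite Rminus_0_r in hN. left. eapply Rle_lt_trans; [apply Rle_abs|exact hN].
Qed.

Lemma ccont_reflect h : ccont h -> ccont (fun y => h (- y)).
Proof.
  intros H. apply (ccont_comp h (fun y => - y) H). intros y.
  apply (continuous_opp (V := R_NormedModule)), continuous_id.
Qed.

Lemma CRInt_reflect h a b : ccont h -> CRInt (fun y => h (- y)) a b = CRInt h (- b) (- a).
Proof.
  intros H. assert (E := CRInt_comp_lin h (-1) 0 a b H).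
  replace (-1 * a + 0) with (- a) in E by ring. replace (-1 * b + 0) with (- b) in E by ring.
  rewrite (CRInt_swap h (- a) (- b) H), <- E.
  rewrite (CRInt_ext (fun y => h (-1 * y + 0)) (fun y => h (- y))) by (intros y; f_equal; ring).
  assert (N : forall z : C, (RtoC (-1) * z)%C = (- z)%C) by (intros z; apply C_ext; simpl; unfold Re, Im; simpl; ring).
  rewrite N. ring.
Qed.

Lemma improper_integral h B : ccont h -> (forall x, Cmod (h x) <= B / (1 + x * x)) ->
  exists l, forall X Y, 0 <= X -> 0 <= Y -> Cmod (l - CRInt h (- X) Y)%C <= B * (atail X + atail Y).
Proof.
  intros H Hb.
  destruct (improper_left h B H ltac:(auto)) as [l1 h1].
  destruct (improper_left (fun y => h (- y)) B (ccont_reflect h H)) as [l2 h2].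
  { intros x _. replace (x * x) with (- x * - x) by ring. apply Hb. }
  exists (l1 + l2)%C. intros X Y hX hY. specialize (h1 X hX). specialize (h2 Y hY).
  rewrite CRInt_reflect, Ropp_0, Ropp_involutive in h2 by auto.
  rewrite <- (CRInt_Chasles h (- X) 0 Y H).
  replace (l1 + l2 - (CRInt h (- X) 0 + CRInt h 0 Y))%C with
    ((l1 - CRInt h (- X) 0) + (l2 - CRInt h 0 Y))%C by ring.
  eapply Rle_trans; [apply Cmod_triangle|]. lra.
Qed.

Lemma is_RInt_CRInt h a b : ccont h -> is_RInt (V := C_R_CompleteNormedModule) h a b (CRInt h a b).
Proof.
  intros H.
  apply (is_RInt_fct_extend_pair (U := R_NormedModule) (V := R_NormedModule) h a b);
    apply (RInt_correct (V := R_CompleteNormedModule)).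
  - exact (ccont_ex_Re h a b H).
  - exact (ccont_ex_Im h a b H).
Qed.

(** Bridge from the filter-based integral in the definition of [fourier] to truncations with
    independent cut-offs. *)
Lemma RInt_gen_improper h B : ccont h -> (forall x, Cmod (h x) <= B / (1 + x * x)) ->
  forall X Y, 0 <= X -> 0 <= Y ->
  Cmod (RInt_gen (V := C_R_CompleteNormedModule) h (Rbar_locally m_infty) (Rbar_locally p_infty)
        - CRInt h (- X) Y)%C <= B * (atail X + atail Y).
Proof.
  intros H Hb. destruct (improper_integral h B H Hb) as [l hl].
  assert (B0 : 0 <= B).
  { specialize (Hb 0). pose proof (Cmod_ge_0 (h 0)). replace (B / (1 + 0 * 0)) with B in Hb by field. lra. }
  rewrite (is_RInt_gen_unique (V := C_R_CompleteNormedModule) h l); [exact hl|].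
  apply filterlimi_locally. intros eps.
  destruct (atail_small (eps / (4 * (B + 1)))) as [A [A0 hA]].
  { apply Rdiv_lt_0_compat; [apply cond_pos|lra]. }
  exists (fun x => x < - A) (fun y => A < y).
  - exists (- A). auto.
  - exists A. auto.
  - intros x y hx hy. simpl. exists (CRInt h x y). split; [apply is_RInt_CRInt, H|].
    assert (E : Cmod (CRInt h x y - l)%C < eps).
    { rewrite Cmod_minus_sym. replace x with (- - x) by ring.
      eapply Rle_lt_trans; [apply hl; lra|].
      assert (h1 := hA (- x) ltac:(lra)). assert (h2 := hA y ltac:(lra)).
      set (d := eps / (4 * (B + 1))) in *.
      assert (Ed : d * (4 * (B + 1)) = eps) by (unfold d; field; lra).
      assert (dp : 0 < d) by (pose proof (atail_pos y); lra).
      apply Rle_lt_trans with (B * (d + d)); [apply Rmult_le_compat_l; lra|]. nra. }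
    split.
    + change (Rabs (Re (CRInt h x y - l)%C) < eps).
      eapply Rle_lt_trans; [apply re_le_Cmod|exact E].
    + change (Rabs (Im (CRInt h x y - l)%C) < eps).
      eapply Rle_lt_trans; [apply Im_le_Cmod|exact E].
Qed.

Lemma schwartz_bound f : schwartz f -> exists B, 0 <= B /\ forall t x, Cmod (f t x) <= B / (1 + x * x).
Proof.
  intros [_ [_ H]]. destruct (H 0%nat 0%nat 0%nat) as [M0 h0], (H 0%nat 0%nat 2%nat) as [M2 h2].
  exists (M0 + M2).
  assert (W : forall t x, Cmod (f t x) <= (M0 + M2) / (1 + x * x)).
  { intros t x. specialize (h0 t x). specialize (h2 t x). unfold dtx in h0, h2. simpl Nat.iter in h0, h2.
    rewrite Cmod_mult, Cmod_R in h0, h2. simpl in h0, h2.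
    rewrite Rabs_R1 in h0. rewrite Rmult_1_r, (Rabs_pos_eq (x * x)) in h2 by nra.
    apply div_le_r; [apply one_sqr_pos|]. lra. }
  split; auto. specialize (W 0 0). pose proof (Cmod_ge_0 (f 0 0)).
  replace ((M0 + M2) / (1 + 0 * 0)) with (M0 + M2) in W by field. lra.
Qed.

(** [fourier] integrates in [x] first, [coef] in [t] first. After truncation in [x] the order can be
    exchanged on a rectangle, and the error is uniform in [k] and [xi] because the exponentials have
    modulus 1. *)
Lemma fourier_truncation f : schwartz f -> exists B, 0 <= B /\ forall k xi X Y, 0 <= X -> 0 <= Y ->
  Cmod (fourier f k xi - CRInt (fun x => (coef f k x * cis (- xi * x)%R)%C) (- X) Y)%C
    <= B * (atail X + atail Y).
Proof.
  intros Hf. destruct (schwartz_bound f Hf) as [B [B0 hB]]. exists B. split; auto.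
  intros k xi X Y hX hY. pose proof PI_RGT_0 as pi0.
  destruct (dtx_regular f Hf 0 0) as [r1 [r2 r3]]. unfold dtx in r1, r2, r3; simpl in r1, r2, r3.
  assert (r4 : ccont2 (dt f)) by apply (dtx_regular f Hf 1 0).
  assert (r5 : ccont2 (dx f)) by apply (dtx_regular f Hf 0 1).
  set (F := fun t x => (f t x * cexpmi (IZR k * t + x * xi))%C).
  set (Et := fun t : R => cis (- IZR k * t)). set (Ex := fun x : R => cis (- xi * x)).
  assert (EF : forall t x, F t x = (f t x * (Et t * Ex x))%C).
  { intros t x. unfold F, Et, Ex. rewrite cexpmi_cis, <- cis_plus. do 2 f_equal. ring. }
  set (Ft := fun t x => (dt f t x * (Et t * Ex x) + f t x * (Ci * RtoC (- IZR k) * Et t * Ex x))%C).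
  set (Fx := fun t x => (dx f t x * (Et t * Ex x) + f t x * (Et t * (Ci * RtoC (- xi) * Ex x)))%C).
  assert (cEt : ccont2 (fun t _ => Et t)) by apply ccont2_t, ccont_cis.
  assert (cEx : ccont2 (fun _ x => Ex x)) by (apply (ccont2_swap (fun x _ => Ex x)), ccont2_t, ccont_cis).
  assert (cF : ccont2 F).
  { replace F with (fun t x => (f t x * (Et t * Ex x))%C).
    - apply ccont2_mult; [auto|apply ccont2_mult; auto].
    - apply functional_extensionality; intros t; apply functional_extensionality; intros x. symmetry; apply EF. }
  assert (cFt : ccont2 Ft).
  { apply ccont2_plus; apply ccont2_mult; auto; [apply ccont2_mult; auto|].
    apply ccont2_mult; auto. apply ccont2_mult; auto. apply ccont2_const. }
  assert (cFx : ccont2 Fx).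
  { apply ccont2_plus; apply ccont2_mult; auto; [apply ccont2_mult; auto|].
    apply ccont2_mult; auto. apply ccont2_mult; auto. apply ccont2_const. }
  assert (DFt : forall x, cderiv (fun t => F t x) (fun t => Ft t x)).
  { intros x. eapply cderiv_ext; [intros t; symmetry; apply EF| |].
    2:{ apply cderiv_mult; [apply (has_dt_cderiv f r1 x)|].
        apply cderiv_mult; [apply cderiv_cis'|apply (cderiv_const (Ex x))]. }
    intros t. unfold Ft, Et, Ex. simpl. ring. }
  assert (DFx : forall t, cderiv (F t) (Fx t)).
  { intros t. eapply cderiv_ext; [intros x; symmetry; apply EF| |].
    2:{ apply cderiv_mult; [apply (has_dx_cderiv f r2 t)|].
        apply cderiv_mult; [apply (cderiv_const (Et t))|apply cderiv_cis']. }
    intros x. unfold Fx, Et, Ex. simpl. ring. }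
  set (l := fun t => RInt_gen (V := C_R_CompleteNormedModule) (F t)
     (Rbar_locally m_infty) (Rbar_locally p_infty)).
  assert (hl : forall t X Y, 0 <= X -> 0 <= Y -> Cmod (l t - CRInt (F t) (- X) Y)%C <= B * (atail X + atail Y)).
  { intros t. refine (RInt_gen_improper (F t) B (ccont2_ccont_x F t cF) _).
    intros x. unfold F. rewrite Cmod_mult, cexpmi_cis, Cmod_cis, Rmult_1_r. apply hB. }
  assert (ct : forall X Y, ccont (fun t => CRInt (F t) (- X) Y)).
  { intros X' Y'. apply (cderiv_ccont _ (fun t => CRInt (Ft t) (- X') Y')).
    apply (cderiv_CRInt_param (fun x t => F t x) (fun x t => Ft t x)); auto.
    - intros t. apply ccont2_ccont_x, cF.
    - apply ccont2_swap, cFt. }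
  (* The inner improper integral is a uniform limit of its truncations, hence continuous in [t], so
     that the outer integral exists. *)
  assert (cl : ccont l).
  { apply ccont_lim. intros A eps _ he.
    destruct (atail_small (eps / (2 * (B + 1)))) as [A' [A0 hA]]; [apply Rdiv_lt_0_compat; lra|].
    exists (fun t => CRInt (F t) (- A') A'). split; auto. intros t _.
    eapply Rle_trans; [apply hl; lra|]. specialize (hA A' (Rle_refl _)).
    set (d := eps / (2 * (B + 1))) in *.
    assert (Ed : d * (2 * (B + 1)) = eps) by (unfold d; field; lra).
    pose proof (atail_pos A').
    apply Rle_trans with (B * (d + d)); [apply Rmult_le_compat_l; lra|]. nra. }
  assert (E1 : fourier f k xi = (RtoC (/ (2 * PI)) * CRInt l 0 (2 * PI))%C).
  { unfold fourier. match goal with |- context [RInt ?h 0 (2 * PI)] => change h with l end.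
    rewrite (is_RInt_unique (V := C_R_CompleteNormedModule) l 0 (2 * PI) _ (is_RInt_CRInt l 0 (2 * PI) cl)).
    apply C_ext; unfold scal, Re, Im; simpl; unfold prod_scal, scal; simpl; unfold mult; simpl; ring. }
  assert (E2 : CRInt (fun x => (coef f k x * cis (- xi * x)%R)%C) (- X) Y =
     (RtoC (/ (2 * PI)) * CRInt (fun t => CRInt (F t) (- X) Y) 0 (2 * PI))%C).
  { rewrite (CRInt_Fubini F Ft Fx) by auto. rewrite <- CRInt_scal.
    - apply CRInt_ext. intros x. unfold coef. fold (Ex x).
      rewrite (CRInt_ext (fun t => F t x) (fun t => (Ex x * (f t x * cis (- IZR k * t)%R))%C)).
      + rewrite CRInt_scal; [ring|]. apply ccont_mult; [apply ccont2_ccont_t, r3|apply ccont_cis].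
      + intros t. rewrite EF. unfold Et. ring.
    - apply (cderiv_ccont _ (fun x => CRInt (fun t => Fx t x) 0 (2 * PI))).
      apply cderiv_CRInt_param; auto. intros x; apply ccont2_ccont_t, cF. }
  rewrite E1, E2.
  replace (RtoC (/ (2 * PI)) * CRInt l 0 (2 * PI) - RtoC (/ (2 * PI)) * CRInt (fun t => CRInt (F t) (- X) Y) 0 (2 * PI))%C
    with (RtoC (/ (2 * PI)) * (CRInt l 0 (2 * PI) - CRInt (fun t => CRInt (F t) (- X) Y) 0 (2 * PI)))%C by ring.
  rewrite <- CRInt_minus by auto. rewrite Cmod_mult, Cmod_R.
  assert (0 < / (2 * PI)) by (apply Rinv_0_lt_compat; lra).
  rewrite Rabs_pos_eq by lra.
  assert (E3 := CRInt_bound_const (fun t => (l t - CRInt (F t) (- X) Y)%C) (B * (atail X + atail Y)) 0 (2 * PI)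
     ltac:(lra) (ccont_minus _ _ cl (ct X Y)) (fun t _ => hl t X Y hX hY)).
  apply Rmult_le_compat_l with (r := / (2 * PI)) in E3; [|lra].
  eapply Rle_trans; [exact E3|]. right. field. lra.
Qed.

(** * Injectivity of the Fourier transform on the line *)

Section Injectivity.
Variables (g : R -> C) (B : R).
Hypothesis gc : ccont g.
Hypothesis gB : forall y, Cmod (g y) <= B / (1 + y * y).
(** The vanishing of the Fourier transform of [g], in the truncated form supplied by
    [fourier_truncation]. *)
Hypothesis g_hat : forall xi X Y, 0 <= X -> 0 <= Y ->
  Cmod (CRInt (fun y => (g y * cis (xi * y))%C) (- X) Y) <= B * (atail X + atail Y).

Lemma decay_const_pos : 0 <= B.
Proof.
  pose proof (gB 0). pose proof (Cmod_ge_0 (g 0)). replace (B / (1 + 0 * 0)) with B in H by field. lra.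
Qed.

Lemma zsum_telescope (H : R -> C) a N : ccont H ->
  zsum (fun n => CRInt H (a + 2 * PI * IZR n) (a + 2 * PI * IZR n + 2 * PI)) N =
  CRInt H (a - 2 * PI * INR N) (a + 2 * PI * INR N).
Proof.
  intros Hc. induction N as [|N IH]; simpl zsum.
  - replace (a - 2 * PI * INR 0) with a by (simpl; ring).
    replace (a + 2 * PI * INR 0) with a by (simpl; ring). rewrite CRInt_point. reflexivity.
  - rewrite IH, minus_IZR, opp_IZR, <- INR_IZR_INZ, S_INR.
    rewrite <- (CRInt_Chasles H (a - 2 * PI * (INR N + 1)) (a - 2 * PI * INR N) (a + 2 * PI * (INR N + 1)) Hc).
    rewrite <- (CRInt_Chasles H (a - 2 * PI * INR N) (a + 2 * PI * INR N) (a + 2 * PI * (INR N + 1)) Hc).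
    replace (a + 2 * PI * INR N + 2 * PI) with (a + 2 * PI * (INR N + 1)) by ring.
    replace (a + 2 * PI * (- INR N - 1)) with (a - 2 * PI * (INR N + 1)) by ring.
    replace (a - 2 * PI * (INR N + 1) + 2 * PI) with (a - 2 * PI * INR N) by ring. ring.
Qed.

Lemma dilate_ccont (h : R -> C) u v : ccont h -> ccont (fun t => h (u * t + v)).
Proof.
  intros H. apply (ccont_comp h (fun t => u * t + v) H). intros t.
  apply (ex_derive_continuous (K := R_AbsRing) (V := R_NormedModule)). auto_derive. trivial.
Qed.

(* The Fourier coefficients of the periodization are the values of the Fourier transform of [g] on a
   lattice, hence vanish. *)
Lemma periodization_zero L t0 : 1 <= L ->
  zlim (fun n => g (L * t0 + L * (2 * PI * IZR n))) = RtoC 0.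
Proof.
  intros hL. pose proof PI_RGT_0 as pi0. pose proof PI2_3_2 as pi3. pose proof decay_const_pos as B0.
  set (phi := fun n t => g (L * t + L * (2 * PI * IZR n))).
  assert (pc : forall n, ccont (phi n)) by (intros n; apply dilate_ccont, gc).
  assert (ls : locsum phi).
  { intros A hA. exists (B * (2 * (1 + A * A))). intros t ht n. unfold phi.
    eapply Rle_trans; [apply gB|]. set (s := L * t + L * (2 * PI * IZR n)).
    apply div_le_l; [apply one_sqr_pos|].
    replace (B * (2 * (1 + A * A)) / (1 + IZR n * IZR n) * (1 + s * s)) with
      (B * (2 * (1 + A * A)) * (1 + s * s) / (1 + IZR n * IZR n)) by (field; pose proof (one_sqr_pos (IZR n)); lra).
    apply div_le_r; [apply one_sqr_pos|].
    replace (B * (2 * (1 + A * A)) * (1 + s * s)) with (B * (2 * (1 + A * A) * (1 + s * s))) by ring.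
    apply Rmult_le_compat_l; auto.
    assert (n2 : Rabs (IZR n) <= Rabs s + A).
    { assert (Rabs (t + 2 * PI * IZR n) <= Rabs s).
      { unfold s. replace (L * t + L * (2 * PI * IZR n)) with (L * (t + 2 * PI * IZR n)) by ring.
        rewrite Rabs_mult, (Rabs_pos_eq L) by lra. pose proof (Rabs_pos (t + 2 * PI * IZR n)). nra. }
      assert (Rabs (IZR n) <= Rabs (2 * PI * IZR n)).
      { rewrite Rabs_mult, (Rabs_pos_eq (2 * PI)) by lra. pose proof (Rabs_pos (IZR n)). nra. }
      assert (Rabs (2 * PI * IZR n) <= Rabs (t + 2 * PI * IZR n) + Rabs t).
      { replace (2 * PI * IZR n) with ((t + 2 * PI * IZR n) - t) at 1 by ring. unfold Rminus at 1.
        eapply Rle_trans; [apply Rabs_triang|]. rewrite Rabs_Ropp. lra. }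
      lra. }
    assert (sq : forall z, z * z = Rabs z * Rabs z) by (intros z; rewrite <- Rabs_mult; symmetry; apply Rabs_pos_eq; nra).
    rewrite (sq (IZR n)), (sq s). pose proof (Rabs_pos (IZR n)). pose proof (Rabs_pos s).
    set (p := Rabs (IZR n)) in *. set (q := Rabs s) in *.
    assert (p * p <= (q + A) * (q + A)) by (apply Rmult_le_compat; lra).
    assert ((q + A) * (q + A) <= 2 * (q * q) + 2 * (A * A)) by (pose proof (Rle_0_sqr (q - A)); unfold Rsqr in *; lra).
    assert (0 <= A * A * (q * q)) by (apply Rmult_le_pos; nra). lra. }
  change (zlim (fun n => phi n t0) = RtoC 0).
  apply (trig_coefs_zero (fun t => zlim (fun n => phi n t))); [apply zlim_ccont; auto|].
  intros j.
  set (psi := fun n t => (phi n t * cis (IZR j * t))%C).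
  assert (psc : forall n, ccont (psi n)) by (intros n; apply ccont_mult; [auto|apply ccont_cis]).
  assert (ls' : locsum psi).
  { intros A hA. destruct (ls A hA) as [C hC]. exists C. intros t ht n. unfold psi.
    rewrite Cmod_mult, Cmod_cis, Rmult_1_r. apply (hC t ht). }
  rewrite (CRInt_ext _ (fun t => zlim (fun n => psi n t))).
  2:{ intros t. destruct (ls (Rabs t + 1)) as [C hC]; [pose proof (Rabs_pos t); lra|].
      rewrite Cmult_comm, <- (zlim_scal C) by (apply hC; lra). apply zlim_ext. intros n. unfold psi. ring. }
  rewrite zlim_CRInt by (auto; lra).
  destruct (locsum_CRInt psi (t0 - PI) (t0 + PI) ltac:(lra) ls' psc) as [B1 hB1].
  apply (zlim_unique B1); auto.
  intros eps he.
  (* A shift by [2 * PI * n] does not affect [cis (j t)], so the integrals of the translates over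
     one period assemble into one integral of [H] over a long interval. *)
  set (H := fun t => (g (L * t + 0) * cis (IZR j * t))%C).
  assert (Hc : ccont H) by (apply ccont_mult; [apply dilate_ccont, gc|apply ccont_cis]).
  set (a := t0 - PI).
  assert (E : forall N, zsum (fun n => CRInt (psi n) (t0 - PI) (t0 + PI)) N = CRInt H (a - 2 * PI * INR N) (a + 2 * PI * INR N)).
  { intros N. rewrite <- zsum_telescope by auto. apply zsum_ext. intros n.
    transitivity (CRInt (fun t => H (t + 2 * PI * IZR n)) (t0 - PI) (t0 + PI)).
    - apply CRInt_ext. intros t. unfold psi, phi, H. f_equal.
      + f_equal. ring.
      + replace (IZR j * (t + 2 * PI * IZR n)) with (IZR j * t + 2 * PI * IZR (j * n)) by (rewrite mult_IZR; ring).
        symmetry; apply cis_2PI_Z.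
    - rewrite CRInt_shift by auto. f_equal. unfold a; ring. }
  destruct (atail_small (eps / (2 * (B + 1)))) as [A [A0 hA]]; [apply Rdiv_lt_0_compat; lra|].
  exists (Z.to_nat (up (A + Rabs a))). intros N hN.
  assert (hN' : A + Rabs a <= INR N).
  { destruct (archimed (A + Rabs a)) as [z1 _]. apply Rle_trans with (IZR (up (A + Rabs a))); [lra|].
    rewrite INR_IZR_INZ. apply IZR_le. lia. }
  rewrite E. replace (RtoC 0 - _)%C with (- CRInt H (a - 2 * PI * INR N) (a + 2 * PI * INR N))%C by ring.
  rewrite Cmod_opp.
  assert (big : INR N <= 2 * PI * INR N) by (pose proof (pos_INR N); nra).
  assert (a1 : a <= Rabs a) by apply Rle_abs.
  assert (a2 : - a <= Rabs a) by (rewrite <- Rabs_Ropp; apply Rle_abs).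
  set (X := L * (2 * PI * INR N - a)). set (Y := L * (a + 2 * PI * INR N)).
  assert (hX : A <= X) by (unfold X; nra). assert (hY : A <= Y) by (unfold Y; nra).
  (* The substitution [y = L * t] turns the frequency [j] into [j / L], to which [g_hat] applies. *)
  assert (E2 : (RtoC L * CRInt H (a - 2 * PI * INR N) (a + 2 * PI * INR N))%C =
     CRInt (fun y => (g y * cis (IZR j / L * y))%C) (- X) Y).
  { replace (- X) with (L * (a - 2 * PI * INR N) + 0) by (unfold X; ring).
    replace Y with (L * (a + 2 * PI * INR N) + 0) by (unfold Y; ring).
    rewrite <- CRInt_comp_lin by (apply ccont_mult; [auto|apply ccont_cis]).
    f_equal. apply CRInt_ext. intros t. unfold H. do 2 f_equal. field. lra. }
  assert (E3 := g_hat (IZR j / L) X Y ltac:(lra) ltac:(lra)).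
  rewrite <- E2, Cmod_mult, Cmod_R, Rabs_pos_eq in E3 by lra.
  pose proof (hA X hX). pose proof (hA Y hY).
  set (d := eps / (2 * (B + 1))) in *.
  assert (Ed : d * (2 * (B + 1)) = eps) by (unfold d; field; lra).
  pose proof (atail_pos X).
  assert (B * (atail X + atail Y) <= B * (d + d)) by (apply Rmult_le_compat_l; lra).
  pose proof (Cmod_ge_0 (CRInt H (a - 2 * PI * INR N) (a + 2 * PI * INR N))). nra.
Qed.

(* All terms of the periodization but the central one are [O(1 / L^2)]. *)
Lemma fourier_injective y0 : g y0 = RtoC 0.
Proof.
  pose proof decay_const_pos as B0. pose proof PI2_3_2 as pi3.
  apply Cmod_small_eq. intros eps he.
  (* [1 + |y0|] keeps the points [y0 + 2 PI L n] with [n <> 0] at modulus at least [L |n|];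
     [16 * B / eps] makes the remainder [16 * B / L^2] at most [eps]. *)
  set (L := 1 + Rabs y0 + 16 * B / eps).
  assert (b1 : 0 <= 16 * B / eps) by (apply Rmult_le_pos; [lra|left; apply Rinv_0_lt_compat; lra]).
  pose proof (Rabs_pos y0) as y0p.
  assert (hL : 1 <= L) by (unfold L; lra).
  assert (P := periodization_zero L (y0 / L) hL).
  set (a := fun n => g (L * (y0 / L) + L * (2 * PI * IZR n))) in *.
  set (a0 := fun n => if Z.eq_dec n 0 then a n else RtoC 0).
  set (b := fun n => if Z.eq_dec n 0 then RtoC 0 else a n).
  assert (Ea : forall n, a n = g (y0 + L * (2 * PI * IZR n))).
  { intros n. unfold a. f_equal. field. lra. }
  assert (Sb : summable (2 * B / (L * L)) b).
  { intros n. unfold b. destruct (Z.eq_dec n 0) as [e|ne].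
    - rewrite Cmod_0. apply Rmult_le_pos; [apply Rmult_le_pos; [lra|left; apply Rinv_0_lt_compat; nra]|].
      left; apply Rinv_0_lt_compat, one_sqr_pos.
    - rewrite Ea. eapply Rle_trans; [apply gB|].
      set (s := y0 + L * (2 * PI * IZR n)). set (p := Rabs (IZR n)).
      assert (p1 : 1 <= p).
      { unfold p. rewrite <- abs_IZR. apply IZR_le. lia. }
      assert (hs : L * p <= Rabs s).
      { assert (h : Rabs (L * (2 * PI * IZR n)) <= Rabs s + Rabs y0).
        { replace (L * (2 * PI * IZR n)) with (s + - y0) by (unfold s; ring).
          eapply Rle_trans; [apply Rabs_triang|]. rewrite Rabs_Ropp. lra. }
        rewrite !Rabs_mult, (Rabs_pos_eq L), (Rabs_pos_eq 2), (Rabs_pos_eq PI) in h by lra.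
        fold p in h. assert (Rabs y0 <= L * p) by (unfold L in *; nra).
        assert (2 * (L * p) <= L * (2 * PI * p)) by nra. lra. }
      assert (sq : forall z, z * z = Rabs z * Rabs z) by (intros z; rewrite <- Rabs_mult; symmetry; apply Rabs_pos_eq; nra).
      rewrite (sq s), (sq (IZR n)). fold p.
      assert (s2 : (L * p) * (L * p) <= Rabs s * Rabs s) by (apply Rmult_le_compat; nra).
      apply div_le_l; [nra|].
      replace (2 * B / (L * L) / (1 + p * p) * (1 + Rabs s * Rabs s)) with
        (B * (2 * (1 + Rabs s * Rabs s)) / ((L * L) * (1 + p * p))) by (field; split; nra).
      apply div_le_r; [nra|]. apply Rmult_le_compat_l; auto.
      assert (L * L * 1 <= L * L * (p * p)) by (apply Rmult_le_compat_l; nra).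
      replace (L * p * (L * p)) with (L * L * (p * p)) in s2 by ring. lra. }
  assert (Sa : summable (Cmod (a 0%Z)) a0).
  { intros n. unfold a0. destruct (Z.eq_dec n 0) as [->|ne].
    - right. field.
    - rewrite Cmod_0. apply Rmult_le_pos; [apply Cmod_ge_0|left; apply Rinv_0_lt_compat, one_sqr_pos]. }
  assert (E : zlim a = (a 0%Z + zlim b)%C).
  { rewrite <- (zlim_ext (fun n => (a0 n + b n)%C)).
    - rewrite (zlim_plus _ _ _ _ Sa Sb). f_equal.
      rewrite (zlim_delta a0 0); [reflexivity|]. intros k hk. unfold a0. destruct Z.eq_dec; [lia|reflexivity].
    - intros n. unfold a0, b. destruct Z.eq_dec; ring. }
  rewrite E in P.
  assert (g0 : g y0 = a 0%Z) by (rewrite Ea; f_equal; ring).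
  rewrite g0. replace (a 0%Z - RtoC 0)%C with ((a 0%Z + zlim b) - zlim b)%C by ring.
  rewrite P. replace (RtoC 0 - zlim b)%C with (- zlim b)%C by ring. rewrite Cmod_opp.
  eapply Rle_trans; [apply (zlim_norm _ _ Sb)|].
  replace (8 * (2 * B / (L * L))) with (16 * B / (L * L)) by (field; lra).
  apply div_le_l; [nra|].
  assert (16 * B <= eps * L).
  { unfold L. replace (eps * (1 + Rabs y0 + 16 * B / eps)) with (eps * (1 + Rabs y0) + 16 * B) by (field; lra). nra. }
  nra.
Qed.
End Injectivity.

(** * The first-order equation on a single mode *)

(** Each quadratic factor costs half of the remaining rate:
    [(1 + s^2) exp(- d s / 2) <= 1 + 16 / d^2] for [s >= 0], and the other factors are left with the
    rate [d / 2]. *)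
Fixpoint exp_poly_const (d : R) (g : nat) : R :=
  match g with
  | O => 1
  | S n => (1 + 16 / (d * d)) * exp_poly_const (d / 2) n
  end.

Lemma exp_poly_bound g : forall d s, 0 < d -> 0 <= s ->
  (1 + s * s) ^ g * exp (- (d * s)) <= exp_poly_const d g.
Proof.
  induction g as [|g IH]; intros d s hd hs; simpl.
  - rewrite Rmult_1_l, <- exp_0. destruct (Req_dec (d * s) 0) as [e|e].
    + rewrite e, Ropp_0. lra.
    + left. apply exp_increasing. assert (0 <= d * s) by (apply Rmult_le_pos; lra). lra.
  - replace (- (d * s)) with (- (d / 2 * s) + - (d / 2 * s)) by field. rewrite exp_plus.
    set (E := exp (- (d / 2 * s))).
    assert (E0 : 0 < E) by apply exp_pos.
    replace ((1 + s * s) * (1 + s * s) ^ g * (E * E)) with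
      (((1 + s * s) * E) * ((1 + s * s) ^ g * E)) by ring.
    apply Rmult_le_compat.
    + apply Rmult_le_pos; [nra|lra].
    + apply Rmult_le_pos; [apply pow_le; nra|lra].
    (* [E] is the inverse of [q * q]; squaring [1 + d s / 4 <= q] produces the term [d^2 s^2 / 16],
       whence the constant 16. *)
    + set (q := exp (d / 4 * s)).
      assert (q1 : 1 + d / 4 * s <= q) by apply exp_ineq1_le.
      assert (Eq : E * (q * q) = 1).
      { unfold E, q. rewrite <- !exp_plus, <- exp_0. f_equal. field. }
      assert (ds : 0 <= d / 4 * s) by (apply Rmult_le_pos; lra).
      assert (q2 : 1 + d * d / 16 * (s * s) <= q * q) by nra.
      assert (q3 : 1 + s * s <= (1 + 16 / (d * d)) * (1 + d * d / 16 * (s * s))).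
      { replace ((1 + 16 / (d * d)) * (1 + d * d / 16 * (s * s))) with
          (1 + s * s + (16 / (d * d) + d * d / 16 * (s * s))) by (field; lra).
        assert (0 <= 16 / (d * d)) by (left; apply Rdiv_lt_0_compat; nra).
        assert (0 <= d * d / 16 * (s * s)) by (apply Rmult_le_pos; nra). lra. }
      assert (c0 : 0 <= 1 + 16 / (d * d)).
      { assert (0 <= 16 / (d * d)) by (left; apply Rdiv_lt_0_compat; nra). lra. }
      apply Rle_trans with ((1 + 16 / (d * d)) * (q * q) * E).
      2:{ right. rewrite Rmult_assoc, (Rmult_comm (q * q)), Eq. ring. }
      apply Rmult_le_compat_r; [lra|]. eapply Rle_trans; [exact q3|].
      apply Rmult_le_compat_l; auto.
    + apply IH; lra.
Qed.

Lemma exp_poly_const_pos g d : 0 < d -> 0 <= exp_poly_const d g.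
Proof.
  intros hd. eapply Rle_trans; [|apply (exp_poly_bound g d 0 hd (Rle_refl 0))].
  apply Rmult_le_pos; [apply pow_le; lra|left; apply exp_pos].
Qed.

(** Moves a weight from [x] to [y] at the price of a weight in [x - y]. It rests on
    [x^2 <= 2 (x - y)^2 + 2 y^2], that is, [(x - 2 y)^2 >= 0]. *)
Lemma peetre x y : 1 + x * x <= 2 * (1 + (x - y) * (x - y)) * (1 + y * y).
Proof.
  assert (0 <= (x - y) * (x - y) * (y * y)) by (apply Rmult_le_pos; apply Rle_0_sqr).
  pose proof (Rle_0_sqr (x - 2 * y)). unfold Rsqr in *. lra.
Qed.

Lemma cexp_neg l x : cexp (- l) x = cexp l (- x).
Proof.
  unfold cexp. simpl. f_equal; [f_equal; f_equal; unfold Re; ring|f_equal; unfold Im; ring].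
Qed.

Section LeftSolution.
Variables (lam : C) (F : R -> C) (B : R).
Hypothesis lam_pos : 0 <= Re lam.
Hypothesis Fc : ccont F.
Hypothesis FB : forall x, Cmod (F x) <= B / (1 + x * x).

Let H (y : R) : C := (cexp lam y * F y)%C.

(** Variation of constants from [-oo]: [w] is the integral of [H] over the left half-line,
    convergent since [exp(Re lam x) <= 1] there. The error in the second clause depends on [x],
    which is harmless as only [X] tends to infinity. *)
Lemma left_solution_exists : exists u, cderiv u (fun x => (F x - lam * u x)%C) /\
  forall x X, 0 <= X ->
    Cmod (u x - cexp (- lam) x * CRInt H (- X) x)%C <= exp (- (Re lam * x)) * (B * atail X).
Proof.
  assert (Hc : ccont H) by (apply ccont_mult; [apply ccont_cexp|exact Fc]).
  destruct (improper_left H B Hc) as [w hw].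
  { intros x hx. unfold H. rewrite Cmod_mult, Cmod_cexp.
    eapply Rle_trans; [|apply FB]. pose proof (Cmod_ge_0 (F x)).
    assert (exp (Re lam * x) <= 1).
    { rewrite <- exp_0. destruct (Req_dec (Re lam * x) 0) as [e|e]; [rewrite e; lra|].
      left. apply exp_increasing. assert (Re lam * x <= 0) by nra. lra. }
    nra. }
  exists (fun x => (cexp (- lam) x * (w + CRInt H 0 x))%C). split.
  - eapply cderiv_ext; [reflexivity| |apply cderiv_mult; [apply cderiv_cexp|apply cderiv_plus; [apply (cderiv_const w)|apply (cderiv_CRInt H 0 Hc)]]].
    intros x. simpl. unfold H.
    replace (F x) with ((cexp lam (- x) * cexp lam x) * F x)%C at 2 by (rewrite cexp_opp; ring).
    rewrite !cexp_neg. ring.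
  - intros x X hX. rewrite <- (CRInt_Chasles H (- X) 0 x Hc).
    replace (cexp (- lam) x * (w + CRInt H 0 x) - cexp (- lam) x * (CRInt H (- X) 0 + CRInt H 0 x))%C with
      (cexp (- lam) x * (w - CRInt H (- X) 0))%C by ring.
    rewrite Cmod_mult, Cmod_cexp.
    replace (Re (- lam)%C * x) with (- (Re lam * x)) by (unfold Re; simpl; ring).
    apply Rmult_le_compat_l; [left; apply exp_pos|auto].
Qed.

(** [C / (1 + y^2)] has total integral [C * PI]. As [C] may depend on the point [x], a weight in [x]
    can be hidden in it. *)
Lemma left_solution_bound u x C : 0 <= C ->
  (forall x X, 0 <= X ->
    Cmod (u x - cexp (- lam) x * CRInt H (- X) x)%C <= exp (- (Re lam * x)) * (B * atail X)) ->
  (forall y, y <= x -> exp (- (Re lam * (x - y))) * Cmod (F y) <= C / (1 + y * y)) ->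
  Cmod (u x) <= C * PI.
Proof.
  intros C0 hu hF. apply Cmod_le_eps. intros eps he.
  assert (Hc : ccont H) by (apply ccont_mult; [apply ccont_cexp|exact Fc]).
  set (c := exp (- (Re lam * x)) * Rabs B + 1).
  assert (c0 : 0 < c).
  { unfold c. pose proof (exp_pos (- (Re lam * x))). pose proof (Rabs_pos B). nra. }
  destruct (atail_small (eps / c)) as [A [A0 hA]]; [apply Rdiv_lt_0_compat; lra|].
  set (X := A + Rabs x).
  assert (hX : A <= X) by (unfold X; pose proof (Rabs_pos x); lra).
  exists (cexp (- lam) x * CRInt H (- X) x)%C. split.
  - eapply Rle_trans; [apply hu; lra|]. specialize (hA X hX). pose proof (atail_pos X).
    assert (B * atail X <= Rabs B * atail X) by (apply Rmult_le_compat_r; [lra|apply Rle_abs]).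
    pose proof (exp_pos (- (Re lam * x))).
    apply Rle_trans with (exp (- (Re lam * x)) * (Rabs B * atail X)); [apply Rmult_le_compat_l; lra|].
    apply Rle_trans with (c * atail X); [unfold c; nra|].
    apply Rle_trans with (c * (eps / c)); [apply Rmult_le_compat_l; lra|]. right; field; lra.
  - rewrite <- CRInt_scal by auto.
    assert (hxX : - X <= x) by (unfold X, Rabs; destruct Rcase_abs; lra).
    eapply Rle_trans; [apply (CRInt_atan_bound _ C); auto|].
    + apply ccont_scal, Hc.
    + intros y hy. unfold H. rewrite !Cmod_mult, !Cmod_cexp.
      replace (exp (Re (- lam)%C * x) * (exp (Re lam * y) * Cmod (F y))) with
        (exp (- (Re lam * (x - y))) * Cmod (F y)).
      * apply hF; lra.
      * rewrite <- Rmult_assoc, <- exp_plus. do 2 f_equal. unfold Re; simpl; ring.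
    + apply Rmult_le_compat_l; auto. pose proof (atan_bound x). pose proof (atan_bound (- X)). lra.
Qed.
End LeftSolution.

(** [2 ^ g] comes from [peetre] and [exp_poly_const d g] from the exponential decay; the 1 covers
    the case [Re lam = 0], and [PI] is the integral of [1 / (1 + y^2)]. *)
Definition ode_const (d : R) (g : nat) : R := (2 ^ g * exp_poly_const d g + 1) * PI.

(** Of the [S g] weights in [y], one is kept for integrability and the others are passed on to [x],
    which has smaller modulus. *)
Lemma monotone_weight g x y M c : x * x <= y * y -> 0 <= c -> (1 + y * y) ^ S g * c <= M ->
  c <= M / (1 + x * x) ^ g / (1 + y * y).
Proof.
  intros hxy hc h. pose proof (one_sqr_pos x) as px. pose proof (one_sqr_pos y) as py.
  pose proof (pow_lt _ g px) as pg.
  apply div_le_r; auto. apply div_le_r; auto. simpl in h.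
  assert ((1 + x * x) ^ g <= (1 + y * y) ^ g) by (apply pow_incr; lra).
  assert (0 <= c * (1 + y * y)) by (apply Rmult_le_pos; lra). nra.
Qed.

(** The final bound involves only [d], [g] and [M], hence is uniform over the modes, and one [u]
    serves all [g]. The constant [B] only controls truncation errors. *)
Lemma ode_nonneg d : 0 < d -> forall lam F B,
  ccont F -> (forall x, Cmod (F x) <= B / (1 + x * x)) ->
  (d <= Re lam \/ (Re lam = 0 /\ forall X Y, 0 <= X -> 0 <= Y ->
     Cmod (CRInt (fun y => (cexp lam y * F y)%C) (- X) Y) <= B * (atail X + atail Y))) ->
  exists u, cderiv u (fun x => (F x - lam * u x)%C) /\
    forall g M, (forall x, (1 + x * x) ^ S g * Cmod (F x) <= M) ->
      forall x, (1 + x * x) ^ g * Cmod (u x) <= ode_const d g * M.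
Proof.
  intros hd lam F B Fc FB hlam. pose proof PI_RGT_0 as pi0.
  assert (lp : 0 <= Re lam) by (destruct hlam as [h|[h _]]; lra).
  destruct (left_solution_exists lam F B lp Fc FB) as [u [hu bu]].
  exists u. split; auto. intros g M hM x.
  pose proof (one_sqr_pos x) as px. pose proof (pow_lt _ g px) as pg.
  assert (M0 : 0 <= M).
  { specialize (hM 0). eapply Rle_trans; [|exact hM].
    apply Rmult_le_pos; [apply pow_le; nra|apply Cmod_ge_0]. }
  pose proof (exp_poly_const_pos g d hd) as K0.
  assert (t2 : 0 <= 2 ^ g) by (apply pow_le; lra).
  assert (tK : 0 <= 2 ^ g * exp_poly_const d g) by (apply Rmult_le_pos; lra).
  assert (Mg : 0 <= M / (1 + x * x) ^ g) by (apply Rmult_le_pos; [lra|left; apply Rinv_0_lt_compat; lra]).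
  assert (fin : Cmod (u x) <= M / (1 + x * x) ^ g * PI -> (1 + x * x) ^ g * Cmod (u x) <= ode_const d g * M).
  { intros h. unfold ode_const. apply Rmult_le_compat_l with (r := (1 + x * x) ^ g) in h; [|lra].
    replace ((1 + x * x) ^ g * (M / (1 + x * x) ^ g * PI)) with (M * PI) in h by (field; lra).
    assert (0 <= M * PI) by (apply Rmult_le_pos; lra). nra. }
  destruct hlam as [h|[h comp]].
  (* Peetre's inequality moves the weight to [y]; its cost in [x - y] is absorbed by
     [exp (- (d * (x - y)))]. *)
  - assert (E := left_solution_bound lam F B Fc u x (2 ^ g * exp_poly_const d g * (M / (1 + x * x) ^ g))
      ltac:(apply Rmult_le_pos; auto) bu).
    assert (E' : Cmod (u x) <= 2 ^ g * exp_poly_const d g * (M / (1 + x * x) ^ g) * PI).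
    { apply E. intros y hy. specialize (hM y). pose proof (one_sqr_pos y) as py.
      pose proof (pow_lt _ g py) as pyg. pose proof (Cmod_ge_0 (F y)) as F0.
      apply div_le_r; auto.
      replace (2 ^ g * exp_poly_const d g * (M / (1 + x * x) ^ g)) with
        (2 ^ g * exp_poly_const d g * M / (1 + x * x) ^ g) by (field; lra).
      apply div_le_r; auto.
      set (s := x - y). assert (s0 : 0 <= s) by (unfold s; lra).
      assert (P : (1 + x * x) ^ g <= 2 ^ g * (1 + s * s) ^ g * (1 + y * y) ^ g).
      { rewrite <- !Rpow_mult_distr. apply pow_incr. split; [lra|apply peetre]. }
      assert (Ex : exp (- (Re lam * s)) <= exp (- (d * s))).
      { destruct (Req_dec (Re lam * s) (d * s)) as [e|e]; [rewrite e; lra|].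
        left. apply exp_increasing. assert (d * s <= Re lam * s) by (apply Rmult_le_compat_r; auto). lra. }
      pose proof (exp_poly_bound g d s hd s0) as EB.
      pose proof (exp_pos (- (Re lam * s))) as e1.
      assert (s2 : 0 < (1 + s * s) ^ g) by (apply pow_lt; nra).
      apply Rle_trans with ((exp (- (d * s)) * Cmod (F y) * (1 + y * y)) * (2 ^ g * (1 + s * s) ^ g * (1 + y * y) ^ g)).
      - apply Rmult_le_compat; [|lra| |exact P].
        + apply Rmult_le_pos; [apply Rmult_le_pos; lra|lra].
        + apply Rmult_le_compat_r; [lra|]. apply Rmult_le_compat_r; auto.
      - replace (exp (- (d * s)) * Cmod (F y) * (1 + y * y) * (2 ^ g * (1 + s * s) ^ g * (1 + y * y) ^ g)) with
          ((2 ^ g * ((1 + s * s) ^ g * exp (- (d * s)))) * ((1 + y * y) ^ S g * Cmod (F y))) by (simpl; ring).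
        apply Rmult_le_compat; auto.
        + apply Rmult_le_pos; [auto|]. apply Rmult_le_pos; [lra|left; apply exp_pos].
        + apply Rmult_le_pos; [left; apply pow_lt; auto|auto].
        + apply Rmult_le_compat_l; auto. }
    unfold ode_const. apply Rmult_le_compat_l with (r := (1 + x * x) ^ g) in E'; [|lra].
    replace ((1 + x * x) ^ g * (2 ^ g * exp_poly_const d g * (M / (1 + x * x) ^ g) * PI)) with
      (2 ^ g * exp_poly_const d g * PI * M) in E' by (field; lra).
    assert (0 <= M * PI) by (apply Rmult_le_pos; lra). nra.
  (* For [x <= 0] the integral runs over [y <= x], where [|y| >= |x|], so [monotone_weight] replaces
     the missing exponential decay. *)
  - apply fin. destruct (Rle_lt_dec x 0) as [xn|xp].
    + apply (left_solution_bound lam F B Fc u x _ Mg bu). intros y hy.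
      rewrite h, Rmult_0_l, Ropp_0, exp_0, Rmult_1_l.
      apply monotone_weight; [nra|apply Cmod_ge_0|apply hM].
    (* For [x > 0] the vanishing total integral turns [u x] into minus an integral over [y >= x],
       where again [|y| >= |x|]. *)
    + apply Cmod_le_eps. intros eps he.
      set (H := fun y => (cexp lam y * F y)%C) in *.
      assert (Hc : ccont H) by (apply ccont_mult; [apply ccont_cexp|exact Fc]).
      (* Three tails at [X]: one from representing [u x] by an integral from [- X], two from the
         integral over [[- X, X]]. *)
      set (c := 3 * (Rabs B + 1)). assert (c0 : 0 < c) by (unfold c; pose proof (Rabs_pos B); lra).
      destruct (atail_small (eps / c)) as [A [A0 hA]]; [apply Rdiv_lt_0_compat; lra|].
      set (X := A + x). specialize (hA X ltac:(unfold X; lra)). pose proof (atail_pos X) as aX.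
      exists (- (cexp (- lam) x * CRInt H x X))%C. split.
      * replace (u x - - (cexp (- lam) x * CRInt H x X))%C with
          ((u x - cexp (- lam) x * CRInt H (- X) x) + cexp (- lam) x * (CRInt H (- X) x + CRInt H x X))%C by ring.
        rewrite CRInt_Chasles by auto.
        eapply Rle_trans; [apply Cmod_triangle|].
        assert (b1 := bu x X ltac:(unfold X; lra)). assert (b2 := comp X X ltac:(unfold X; lra) ltac:(unfold X; lra)).
        fold H in b1. rewrite h, Rmult_0_l, Ropp_0, exp_0, Rmult_1_l in b1.
        rewrite Cmod_mult, Cmod_cexp.
        replace (Re (- lam)%C * x) with 0 by (change (Re (- lam)%C) with (- Re lam); rewrite h; ring).
        rewrite exp_0, Rmult_1_l.
        assert (B * atail X <= Rabs B * atail X) by (apply Rmult_le_compat_r; [lra|apply Rle_abs]).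
        apply Rle_trans with (c * atail X); [unfold c; lra|].
        apply Rle_trans with (c * (eps / c)); [apply Rmult_le_compat_l; lra|]. right; field; lra.
      * rewrite Cmod_opp, Cmod_mult, Cmod_cexp.
        replace (Re (- lam)%C * x) with 0 by (change (Re (- lam)%C) with (- Re lam); rewrite h; ring).
        rewrite exp_0, Rmult_1_l.
        eapply Rle_trans; [apply (CRInt_atan_bound H (M / (1 + x * x) ^ g) x X); [unfold X; lra|auto|]|].
        -- intros y hy. unfold H. rewrite Cmod_mult, Cmod_cexp, h, Rmult_0_l, exp_0, Rmult_1_l.
           apply monotone_weight; [nra|apply Cmod_ge_0|apply hM].
        -- apply Rmult_le_compat_l; auto. pose proof (atan_bound x). pose proof (atan_bound X). lra.
Qed.

(** For [Re lam < 0] the reflection [y -> - y] exchanges the two ends and changes the signs of [lam]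
    and of [F], which gives the integral from [+oo]. *)
Lemma ode_solution d : 0 < d -> forall lam F B,
  ccont F -> (forall x, Cmod (F x) <= B / (1 + x * x)) ->
  (d <= Rabs (Re lam) \/ (Re lam = 0 /\ forall X Y, 0 <= X -> 0 <= Y ->
     Cmod (CRInt (fun y => (cexp lam y * F y)%C) (- X) Y) <= B * (atail X + atail Y))) ->
  exists u, cderiv u (fun x => (F x - lam * u x)%C) /\
    forall g M, (forall x, (1 + x * x) ^ S g * Cmod (F x) <= M) ->
      forall x, (1 + x * x) ^ g * Cmod (u x) <= ode_const d g * M.
Proof.
  intros hd lam F B Fc FB [h|h]; [|apply (ode_nonneg d hd lam F B); auto].
  destruct (Rle_lt_dec 0 (Re lam)) as [p|p].
  - apply (ode_nonneg d hd lam F B); auto. rewrite Rabs_pos_eq in h; auto.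
  - destruct (ode_nonneg d hd (- lam)%C (fun y => (- F (- y)%R)%C) B) as [v [hv bv]].
    + apply ccont_opp, ccont_reflect, Fc.
    + intros x. rewrite Cmod_opp. replace (x * x) with (- x * - x) by ring. apply FB.
    + left. change (Re (- lam)%C) with (- Re lam). rewrite Rabs_left in h; auto.
    + exists (fun x => v (- x)). split.
      * eapply cderiv_ext; [| |apply (cderiv_comp_lin v _ (-1) 0 hv)].
        -- intros x. simpl. f_equal. ring.
        -- intros x. simpl. replace (-1 * x + 0) with (- x) by ring. rewrite Ropp_involutive.
           apply C_ext; simpl; ring.
      * intros g M hM x. replace (x * x) with (- x * - x) by ring. apply bv. intros y.
        rewrite Cmod_opp. replace (y * y) with (- y * - y) by ring. apply hM.
Qed.

(** * Solving mode by mode *)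

(** For [a <> 0] the values are spaced by [|a|], so only the two integers around the root
    [r = - b / a] can come close to 0. *)
Lemma affine_gap_R (a b : R) : exists d, 0 < d /\ forall k : Z, a * IZR k + b = 0 \/ d <= Rabs (a * IZR k + b).
Proof.
  destruct (Req_dec a 0) as [->|ha].
  - destruct (Req_dec b 0) as [->|hb].
    + exists 1. split; [lra|]. intros k; left; ring.
    + exists (Rabs b). split; [apply Rabs_pos_lt; auto|]. intros k; right.
      replace (0 * IZR k + b) with b by ring. lra.
  - set (r := - b / a). set (n := up r). destruct (archimed r) as [n1 n2]. fold n in n1, n2.
    assert (ex : exists e, 0 < e /\ forall k : Z, IZR k - r = 0 \/ e <= Rabs (IZR k - r)).
    { assert (G : forall k : Z, (n <= k)%Z -> IZR n - r <= Rabs (IZR k - r)).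
      { intros k hk. apply IZR_le in hk. rewrite Rabs_pos_eq; lra. }
      assert (G' : forall k : Z, (k <= n - 2)%Z -> 1 <= Rabs (IZR k - r)).
      { intros k hk. apply IZR_le in hk. rewrite minus_IZR in hk. rewrite Rabs_left1; lra. }
      assert (G'' : forall k : Z, k = (n - 1)%Z -> IZR k - r = IZR n - 1 - r).
      { intros k ->. rewrite minus_IZR. ring. }
      (* [n = up r] satisfies [n - 1 <= r < n], so the value 0 is attained only if [n - 1 = r]. *)
      destruct (Req_dec (IZR n - 1 - r) 0) as [e0|e0].
      - exists (Rmin 1 (IZR n - r)). split; [apply Rmin_glb_lt; lra|]. intros k.
        pose proof (Rmin_l 1 (IZR n - r)). pose proof (Rmin_r 1 (IZR n - r)).
        destruct (Z_lt_le_dec k (n - 1)) as [h|h]; [right; specialize (G' k ltac:(lia)); lra|].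
        destruct (Z.eq_dec k (n - 1)) as [h'|h']; [left; rewrite (G'' k h'); exact e0|].
        right; specialize (G k ltac:(lia)); lra.
      - exists (Rmin (Rabs (IZR n - 1 - r)) (Rmin 1 (IZR n - r))).
        split; [repeat apply Rmin_glb_lt; try lra; apply Rabs_pos_lt; auto|]. intros k. right.
        pose proof (Rmin_l (Rabs (IZR n - 1 - r)) (Rmin 1 (IZR n - r))).
        pose proof (Rmin_r (Rabs (IZR n - 1 - r)) (Rmin 1 (IZR n - r))).
        pose proof (Rmin_l 1 (IZR n - r)). pose proof (Rmin_r 1 (IZR n - r)).
        destruct (Z_lt_le_dec k (n - 1)) as [h|h]; [specialize (G' k ltac:(lia)); lra|].
        destruct (Z.eq_dec k (n - 1)) as [h'|h']; [rewrite (G'' k h'); lra|].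
        specialize (G k ltac:(lia)); lra. }
    destruct ex as [e [e0 he]]. exists (Rabs a * e). split.
    { apply Rmult_lt_0_compat; auto. apply Rabs_pos_lt; auto. }
    intros k. replace (a * IZR k + b) with (a * (IZR k - r)) by (unfold r; field; auto).
    destruct (he k) as [h|h]; [left; rewrite h; ring|right].
    rewrite Rabs_mult. apply Rmult_le_compat_l; [apply Rabs_pos|auto].
Qed.

Lemma affine_gap_C (a b : C) : exists d, 0 < d /\
  forall k : Z, (a * RtoC (IZR k) + b)%C = RtoC 0 \/ d <= Cmod (a * RtoC (IZR k) + b)%C.
Proof.
  destruct (affine_gap_R (Re a) (Re b)) as [d1 [p1 h1]], (affine_gap_R (Im a) (Im b)) as [d2 [p2 h2]].
  exists (Rmin d1 d2). split; [apply Rmin_glb_lt; auto|]. intros k.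
  set (z := (a * RtoC (IZR k) + b)%C).
  assert (rz : Re z = Re a * IZR k + Re b) by (unfold z, Re; simpl; ring).
  assert (iz : Im z = Im a * IZR k + Im b) by (unfold z, Im; simpl; ring).
  pose proof (Rmin_l d1 d2). pose proof (Rmin_r d1 d2).
  pose proof (re_le_Cmod z). pose proof (Im_le_Cmod z).
  destruct (h1 k) as [e1|e1]; [|right; rewrite <- rz in e1; lra].
  destruct (h2 k) as [e2|e2]; [|right; rewrite <- iz in e2; lra].
  left. apply C_ext; [rewrite rz; exact e1|rewrite iz; exact e2].
Qed.

Lemma rapid_of_bound phi : (forall m g : nat, exists M, forall k x,
  (1 + IZR k * IZR k) ^ m * (1 + x * x) ^ g * Cmod (phi k x) <= M) -> rapid phi.
Proof.
  intros H m g. destruct (H m g) as [M hM]. exists M. intros k x.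
  eapply Rle_trans; [|apply (hM k x)]. apply Rmult_le_compat_r; [apply Cmod_ge_0|].
  assert (A : forall y n, 0 <= Rabs y ^ n <= (1 + y * y) ^ n).
  { intros y n. split; [apply pow_le, Rabs_pos|]. apply pow_incr. split; [apply Rabs_pos|].
    unfold Rabs; destruct Rcase_abs; nra. }
  apply Rmult_le_compat; apply A.
Qed.

Section Solve.
Variables (c1 c2 c3 : C) (f : R -> R -> C).
Hypothesis Hf : schwartz f.
Hypothesis Hcomp : forall (k : Z) (xi : R), symb c1 c2 c3 k xi = RtoC 0 -> fourier f k xi = RtoC 0.

(** Leaves only the mode equations to solve: the operator acts termwise on [synth phi], and [f] is
    the synthesis of its own coefficients. *)
Lemma solution_from_modes phi phi' : smooth_rapid phi -> smooth_rapid phi' -> (forall k, cderiv (phi k) (phi' k)) ->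
  (forall k x, (c1 * (Ci * RtoC (IZR k) * phi k x) + (c2 * phi' k x + c3 * phi k x))%C = coef f k x) ->
  exists u, schwartz u /\ (forall t x, Lop c1 c2 c3 u t x = f t x).
Proof.
  intros H H' D E. exists (synth phi). split; [apply synth_schwartz, H|].
  intros t x. unfold Lop. rewrite (synth_dt phi H).
  rewrite (proj1 (cderiv_dx (synth phi) (synth phi') (fun t => synth_cderiv_x phi phi' t H H' D))).
  rewrite (fourier_inversion f Hf).
  pose proof (smooth_rapid_is_rapid _ H) as R0. pose proof (smooth_rapid_is_rapid _ H') as R1. pose proof (rapid_mult_k _ R0) as R2.
  rewrite <- (synth_scal c1) by exact R2. rewrite <- (synth_scal c2) by exact R1.
  rewrite <- (synth_scal c3) by exact R0.
  rewrite <- Cplus_assoc.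
  rewrite <- (synth_plus _ _ t x (rapid_scal c2 _ R1) (rapid_scal c3 _ R0)).
  rewrite <- (synth_plus _ _ t x (rapid_scal c1 _ R2) (rapid_plus _ _ (rapid_scal c2 _ R1) (rapid_scal c3 _ R0))).
  unfold synth. apply zlim_ext. intros k. rewrite E. reflexivity.
Qed.

Lemma coef_decay k : exists B, 0 <= B /\ forall x, Cmod (coef f k x) <= B / (1 + x * x).
Proof.
  destruct (rapid_bound _ (coef_rapid f Hf 0) 0 1) as [M [M0 hM]]. exists M. split; auto.
  intros x. specialize (hM k x). apply div_le_r; [apply one_sqr_pos|].
  simpl in hM. change (coef (dtx 0 0 f) k x) with (coef f k x) in hM. lra.
Qed.

Lemma coef_ccont k : ccont (coef f k).
Proof. apply (cderiv_ccont _ _ (coef_cderiv f Hf 0 k)). Qed.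

Lemma solve_no_dx : c1 <> RtoC 0 -> c2 = RtoC 0 ->
  exists u, schwartz u /\ (forall t x, Lop c1 c2 c3 u t x = f t x).
Proof.
  intros n1 e2. set (p := fun k : Z => (Ci * c1 * RtoC (IZR k) + c3)%C).
  (* With [c2 = 0] the symbol does not involve [xi], so a zero of [p] makes the transform vanish for
     every [xi], as [fourier_injective] requires. *)
  assert (vanish : forall k x, p k = RtoC 0 -> coef f k x = RtoC 0).
  { intros k x hp. destruct (coef_decay k) as [B1 [p1 h1]], (fourier_truncation f Hf) as [B2 [p2 h2]].
    apply (fourier_injective (coef f k) (B1 + B2)).
    - apply coef_ccont.
    - intros y. eapply Rle_trans; [apply h1|]. apply Rmult_le_compat_r; [|lra].
      left; apply Rinv_0_lt_compat, one_sqr_pos.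
    - intros xi X Y hX hY. specialize (h2 k (- xi) X Y hX hY).
      rewrite (Hcomp k (- xi)), Ropp_involutive in h2.
      + set (I := CRInt (fun y => (coef f k y * cis (xi * y))%C) (- X) Y) in *.
        replace (RtoC 0 - I)%C with (- I)%C in h2 by ring. rewrite Cmod_opp in h2.
        pose proof (atail_pos X). pose proof (atail_pos Y).
        assert (0 <= B1 * (atail X + atail Y)) by (apply Rmult_le_pos; lra). lra.
      + unfold symb. rewrite e2. transitivity (p k); [unfold p; ring|exact hp]. }
  destruct (affine_gap_C (Ci * c1) c3) as [d [d0 hd]].
  set (Phi := fun b k x => (/ p k * coef (dtx 0 b f) k x)%C).
  assert (PR : forall b, rapid (Phi b)).
  { intros b. assert (i0 : 0 <= / d) by (left; apply Rinv_0_lt_compat, d0).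
    (* The inverse is total: at a zero of [p] it has some fixed value, covered by the second
       summand. There the coefficient of [f] is 0, so the mode equation holds whatever this value
       is. *)
    apply (rapid_dominated (coef (dtx 0 b f)) _ (/ d + Cmod (/ RtoC 0)%C) 0 0).
    - pose proof (Cmod_ge_0 (/ RtoC 0)%C). lra.
    - intros k x. unfold Phi. rewrite Cmod_mult. apply Rmult_le_compat_r; [apply Cmod_ge_0|]. simpl.
      assert (Cmod (/ p k)%C <= / d + Cmod (/ RtoC 0)%C).
      { pose proof (Cmod_ge_0 (/ RtoC 0)%C). destruct (hd k) as [z|z]; fold (p k) in z.
        - rewrite z. lra.
        - rewrite Cmod_inv.
          + assert (/ Cmod (p k) <= / d) by (apply Rinv_le_contravar; auto). lra.
          + intros e. rewrite e, Cmod_0 in z. lra. }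
      pose proof (Cmod_ge_0 (/ RtoC 0)%C). lra.
    - apply coef_rapid, Hf. }
  assert (PD : forall b k, cderiv (Phi b k) (Phi (S b) k)) by (intros b k; apply cderiv_scal, coef_cderiv, Hf).
  apply (solution_from_modes (Phi 0%nat) (Phi 1%nat)).
  - exists Phi. auto.
  - exists (fun b => Phi (S b)). auto.
  - apply PD.
  - intros k x. rewrite e2. unfold Phi. change (dtx 0 0 f) with f.
    destruct (hd k) as [z|z]; fold (p k) in z.
    + rewrite (vanish k x z). ring.
    + assert (np : p k <> RtoC 0) by (intros e; rewrite e, Cmod_0 in z; lra).
      replace (c1 * (Ci * RtoC (IZR k) * (/ p k * coef f k x)) +
        (RtoC 0 * (/ p k * coef (dtx 0 1 f) k x) + c3 * (/ p k * coef f k x)))%C with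
        ((Ci * c1 * RtoC (IZR k) + c3) * / p k * coef f k x)%C by ring.
      fold (p k). rewrite Cinv_r by auto. ring.
Qed.

Lemma solve_dx : c2 <> RtoC 0 ->
  exists u, schwartz u /\ (forall t x, Lop c1 c2 c3 u t x = f t x).
Proof.
  intros n2. set (al := (Ci * c1 / c2)%C). set (be := (c3 / c2)%C).
  set (lam := fun k : Z => (al * RtoC (IZR k) + be)%C).
  set (F := fun b k x => (/ c2 * coef (dtx 0 b f) k x)%C).
  assert (FR : forall b, rapid (F b)) by (intros b; apply rapid_scal, coef_rapid, Hf).
  assert (FD : forall b k, cderiv (F b k) (F (S b) k)) by (intros b k; apply cderiv_scal, coef_cderiv, Hf).
  assert (c2p : 0 < Cmod (/ c2)%C).
  { rewrite Cmod_inv by auto. apply Rinv_0_lt_compat, Cmod_gt_0, n2. }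
  (* The gap is taken for [Re (lam k)] alone, since the real part decides on exponential decay. *)
  destruct (affine_gap_R (Re al) (Re be)) as [d [d0 hd]].
  assert (Rlam : forall k, Re (lam k) = Re al * IZR k + Re be) by (intros k; unfold lam, Re; simpl; ring).
  assert (modes : forall k, exists u, cderiv u (fun x => (F 0%nat k x - lam k * u x)%C) /\
    forall g M, (forall x, (1 + x * x) ^ S g * Cmod (F 0%nat k x) <= M) ->
      forall x, (1 + x * x) ^ g * Cmod (u x) <= ode_const d g * M).
  { intros k. destruct (coef_decay k) as [B1 [p1 h1]], (fourier_truncation f Hf) as [B2 [p2 h2]].
    assert (w : forall y z, 0 <= z -> y <= B1 * z \/ y <= B2 * z -> Cmod (/ c2)%C * y <= Cmod (/ c2)%C * (B1 + B2) * z).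
    { intros y z hz hy. rewrite Rmult_assoc. apply Rmult_le_compat_l; [lra|].
      assert (0 <= B1 * z) by (apply Rmult_le_pos; lra). assert (0 <= B2 * z) by (apply Rmult_le_pos; lra). lra. }
    apply (ode_solution d d0 (lam k) (F 0%nat k) (Cmod (/ c2)%C * (B1 + B2))).
    - apply (cderiv_ccont _ _ (FD 0%nat k)).
    - intros x. unfold F. change (dtx 0 0 f) with f. rewrite Cmod_mult. apply w; [|left; apply h1].
      left; apply Rinv_0_lt_compat, one_sqr_pos.
    - rewrite Rlam. destruct (hd k) as [z|z]; [right|left; exact z]. split; [exact z|].
      rewrite <- Rlam in z. intros X Y hX hY.
      (* The symbol is [c2 * (lam k + Ci * xi)], so this is its zero when [Re (lam k) = 0]; moreover
         [cexp (lam k)] is then the Fourier exponential at [xi]. *)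
      set (xi := - Im (lam k)).
      rewrite (CRInt_ext _ (fun y => (/ c2 * (coef f k y * cis (- xi * y)%R))%C)).
      + rewrite CRInt_scal by (apply ccont_mult; [apply coef_ccont|apply ccont_cis]).
        rewrite Cmod_mult. pose proof (atail_pos X). pose proof (atail_pos Y).
        apply w; [lra|right].
        specialize (h2 k xi X Y hX hY). rewrite (Hcomp k xi) in h2.
        * set (I := CRInt (fun x => (coef f k x * cis (- xi * x)%R)%C) (- X) Y) in *.
          replace (RtoC 0 - I)%C with (- I)%C in h2 by ring. rewrite Cmod_opp in h2. exact h2.
        * unfold symb.
          transitivity (c2 * (lam k + Ci * RtoC xi))%C; [unfold lam, al, be; field; auto|].
          replace (lam k + Ci * RtoC xi)%C with (RtoC 0); [ring|].
          apply C_ext; [|unfold xi; simpl; unfold Im; ring].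
          change (0 = Re (lam k) + (0 * xi - 1 * 0)). rewrite z. ring.
      + intros y. unfold F, cexp. change (dtx 0 0 f) with f.
        rewrite z, Rmult_0_l, exp_0. unfold xi. rewrite Ropp_involutive. ring. }
  set (u := fun k => proj1_sig (constructive_indefinite_description _ (modes k))).
  assert (hu := fun k => proj2_sig (constructive_indefinite_description _ (modes k))).
  fold u in hu. change (forall k, cderiv (u k) (fun x => (F 0%nat k x - lam k * u k x)%C) /\
    forall g M, (forall x, (1 + x * x) ^ S g * Cmod (F 0%nat k x) <= M) ->
      forall x, (1 + x * x) ^ g * Cmod (u k x) <= ode_const d g * M) in hu.
  assert (uR : rapid u).
  { apply rapid_of_bound. intros m g.
    destruct (rapid_bound _ (FR 0%nat) m (S g)) as [M [M0 hM]].
    exists (ode_const d g * M). intros k x.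
    assert (pk : 0 < (1 + IZR k * IZR k) ^ m) by (apply pow_lt, one_sqr_pos).
    (* The bound for a mode is linear in [M] with a constant free of [k], so the decay in [k] of the
       data carries over to [u]. *)
    assert (E := proj2 (hu k) g (M / (1 + IZR k * IZR k) ^ m)).
    assert (E' : (1 + x * x) ^ g * Cmod (u k x) <= ode_const d g * (M / (1 + IZR k * IZR k) ^ m)).
    { apply E. intros y. apply div_le_r; auto. specialize (hM k y). lra. }
    apply Rmult_le_compat_l with (r := (1 + IZR k * IZR k) ^ m) in E'; [|lra].
    replace ((1 + IZR k * IZR k) ^ m * (ode_const d g * (M / (1 + IZR k * IZR k) ^ m))) with
      (ode_const d g * M) in E' by (field; lra). lra. }
  (* The derivatives of [u k] are obtained by differentiating the equation repeatedly; rapid decay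
     is inherited because [lam k] grows at most linearly in [k]. *)
  set (Phi := fix Phi (b : nat) : Z -> R -> C :=
    match b with
    | O => u
    | S n => fun k x => (F n k x - lam k * Phi n k x)%C
    end).
  assert (PD : forall b k, cderiv (Phi b k) (Phi (S b) k)).
  { induction b as [|b IH]; intros k; [apply hu|].
    eapply cderiv_ext; [| |apply (cderiv_plus _ _ _ _ (FD b k) (cderiv_scal (- lam k)%C _ _ (IH k)))];
      intros x; simpl; ring. }
  assert (PR : forall b, rapid (Phi b)).
  { induction b as [|b IH]; [exact uR|].
    assert (E : Phi (S b) = fun k x => (F b k x + (- lam k) * Phi b k x)%C).
    { apply functional_extensionality; intros k. apply functional_extensionality; intros x. simpl. ring. }
    rewrite E. apply (rapid_plus _ _ (FR b)).
    apply (rapid_dominated (Phi b) _ (Cmod al + Cmod be) 1 0); [|intros k x|exact IH].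
    - pose proof (Cmod_ge_0 al). pose proof (Cmod_ge_0 be). lra.
    - rewrite Cmod_mult, Cmod_opp. apply Rmult_le_compat_r; [apply Cmod_ge_0|]. simpl.
      eapply Rle_trans; [apply Cmod_triangle|]. rewrite Cmod_mult, Cmod_R.
      pose proof (Cmod_ge_0 al). pose proof (Cmod_ge_0 be). pose proof (Rabs_pos (IZR k)). nra. }
  apply (solution_from_modes (Phi 0%nat) (Phi 1%nat)).
  - exists Phi. auto.
  - exists (fun b => Phi (S b)). auto.
  - apply PD.
  - intros k x. change (Phi 1%nat k x) with (F 0%nat k x - lam k * Phi 0%nat k x)%C.
    unfold F, lam, al, be. change (dtx 0 0 f) with f. field. auto.
Qed.
End Solve.

Theorem theorem4p2 (c1 c2 c3 : C) :
  (c1 <> 0%C \/ c2 <> 0%C) ->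
  forall f : R -> R -> C,
    schwartz f ->
    (forall (k : Z) (xi : R), symb c1 c2 c3 k xi = 0%C -> fourier f k xi = 0%C) ->
    exists u : R -> R -> C, schwartz u /\ (forall t x, Lop c1 c2 c3 u t x = f t x).
Proof.
  intros H f Hf Hcomp. destruct (Ceq_dec c2 0%C) as [e2|n2].
  - apply solve_no_dx; auto. destruct H as [h|h]; [exact h|contradiction].
  - apply solve_dx; auto.
Qed.
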